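(* Let $\frac12<\delta<1$ and $0<\rho<2-\frac1\delta$ be given. Let $k=k(d)$ and $N=N(d)$ be integers with $1\le k<d<N$ such that $$\delta_d:=\frac dN\to\delta,\qquad \rho_d:=\frac kd\to\rho\qquad\text{as } d\to\infty .$$ Then the Cover--Efron cones $C_N$ in $\mathbb{R}^d$ satisfy $$\binom Nk-\mathbb{E} f_k(C_N)=\frac1N\,e^{N G(\delta_d,\rho_d)}\cdot h(d),$$ where $h$ remains in a bounded positive interval, i.e. there are constants $0<a\le b<\infty$, independent of $d$, with $a\le h(d)\le b$ for all $d$. In particular, $$\lim_{d\to\infty}\left[\binom Nk-\mathbb{E} f_k(C_N)\right]=\begin{cases}0&\text{if }\rho<\rho_S(\delta),\\ \infty&\text{if }\rho>\rho_S(\delta).\end{cases}$$ If $\rho=\rho_S(\delta)$, then the numbers $N=N(d)$ and $k=k(d)$ (integers with $1\le k<d<N$, $\frac dN\to\delta$ and $\frac kd\to\rho$ as $d\to\infty$) can be chosen such that $$\liminf_{d\to\infty}\left[\binom Nk-\mathbb{E} f_k(C_N)\right]=0\quad\text{and}\quad\limsup_{d\to\infty}\left[\binom Nk-\mathbb{E} f_k(C_N)\right]=\infty.$$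
   Context: For each $d$, let $\phi=\phi_d$ be a probability measure on $\mathbb{R}^d$ which is even (i.e. $\phi(A)=\phi(-A)$ for Borel sets $A$) and assigns measure zero to each hyperplane through the origin. For $N\ge d+1$ let $X_1,\dots,X_N$ be independent random vectors with distribution $\phi$, and let $\mathrm{pos}$ denote the positive hull (set of all nonnegative linear combinations). The Cover--Efron cone $C_N$ is the random cone whose distribution is that of $\mathrm{pos}\{X_1,\dots,X_N\}$ conditioned on the event that this positive hull is different from $\mathbb{R}^d$. For a polyhedral convex cone $C\subset\mathbb{R}^d$ and $k\in\{1,\dots,d-1\}$, $f_k(C)$ denotes the number of $k$-dimensional faces of $C$. $\mathbb{E}$ denotes expectation. The binary entropy function with base $e$ is $\mathsf{H}(x):=-x\log x-(1-x)\log(1-x)$ for $0\le x\le1$ (with $0\log 0=0$), and $$G(\delta,\rho):=\mathsf{H}(\delta)+\delta\,\mathsf{H}(\rho)-(1-\rho\delta)\log2\qquad\text{for }\rho,\delta\in[0,1].$$ For fixed $\delta\in(1/2,1)$, the function $x\mapsto G(\delta,x)$ has a unique zero in $[0,1]$ (a known fact), which is denoted by $\rho_S(\delta)$. *)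

(* Defs.v *)
From HB Require Import structures.
From mathcomp Require Import all_boot all_order all_algebra.
From mathcomp Require Import all_classical all_reals all_analysis.

Set Implicit Arguments.
Unset Strict Implicit.
Unset Printing Implicit Defensive.

Import Order.TTheory GRing.Theory Num.Theory.
Import numFieldNormedType.Exports.

Local Open Scope classical_set_scope.
Local Open Scope ring_scope.

(* R^d is the space of row vectors, with its Borel sigma-algebra. *)
Definition borel_rV (R : realType) (d : nat) :=
  g_sigma_algebraType (@open 'rV[R]_d).

Section Cones.
Context (R : realType) (d : nat).
Implicit Types C F : set 'rV[R]_d.

Definition positive_hull (N : nat) (x : 'I_N -> 'rV[R]_d) : set 'rV[R]_d :=
  [set y | exists2 c : 'I_N -> R,
             forall i, 0 <= c i & y = \sum_(i < N) c i *: x i].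

Definition is_face C F : Prop :=
  [/\ F !=set0, F `<=` C,
      convex_set (F : set (convex_lmodType 'rV[R]_d)) &
      forall (x y : 'rV[R]_d) (t : R), C x -> C y -> 0 < t < 1 ->
        F ((1 - t) *: x + t *: y) -> F x /\ F y].

(* The dimension of the linear hull. A nonempty face of a convex cone with
   apex 0 contains 0, so for such faces the linear hull is the affine hull. *)
Definition has_dim F (k : nat) : Prop :=
  exists U : {vspace 'rV[R]_d},
    [/\ F `<=` [set` U],
        forall W : {vspace 'rV[R]_d}, F `<=` [set` W] -> (U <= W)%VS &
        \dim U = k].

Definition face_number C (k : nat) : \bar R :=
  counting [set F | is_face C F /\ has_dim F k].

End Cones.

Section CoverEfron.
Context (R : realType) (disp : measure_display) (T : measurableType disp).
Context (P : probability T R).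

Definition mutually_independent (d N : nat)
    (X : 'I_N -> {RV P >-> borel_rV R d}) : Prop :=
  forall (J : {set 'I_N}) (A : 'I_N -> set (borel_rV R d)),
    (forall i, i \in J -> measurable (A i)) ->
    P (\bigcap_(i in [set` J]) X i @^-1` A i)
    = (\prod_(i in J) P (X i @^-1` A i))%E.

Definition cond_expectation (E : set T) (f : T -> \bar R) : \bar R :=
  ((\int[P]_(w in E) f w) / P E)%E.

(* The expectation of f_k(C_N) for the Cover-Efron cone C_N, that is, for
   pos{X_1, ..., X_N} conditioned on being different from R^d. *)
Definition expected_face_number (d N : nat)
    (X : 'I_N -> {RV P >-> borel_rV R d}) (k : nat) : \bar R :=
  let C w := positive_hull (fun i => X i w : 'rV[R]_d) in
  cond_expectation [set w | C w <> setT] (fun w => face_number (C w) k).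

Definition face_deficit (d N : nat)
    (X : 'I_N -> {RV P >-> borel_rV R d}) (k : nat) : \bar R :=
  ('C(N, k)%:R%:E - expected_face_number X k)%E.

End CoverEfron.

Section Threshold.
Context (R : realType).

(* ln 0 = 0, which agrees with the convention 0 log 0 = 0. *)
Definition binary_entropy (x : R) : R :=
  - x * ln x - (1 - x) * ln (1 - x).

Definition threshold_exponent (delta rho : R) : R :=
  binary_entropy delta + delta * binary_entropy rho
  - (1 - rho * delta) * ln 2.

(* For 1/2 < delta < 1 this is the unique zero of threshold_exponent delta
   in [0, 1]; the default value 0 of xget is not used. *)
Definition rho_S (delta : R) : R :=
  xget 0 [set x : R | 0 <= x <= 1 /\ threshold_exponent delta x = 0].

(* The condition 1 <= k < d has no solution for d < 2, hence sequences in d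
   start at d = 2; their values at 0 and 1 are irrelevant. *)
Definition admissible (delta rho : R) (k N : nat -> nat) : Prop :=
  [/\ forall d, (2 <= d)%N -> [/\ (1 <= k d)%N, (k d < d)%N & (d < N d)%N],
      (fun d => d%:R / (N d)%:R : R) @ \oo --> delta &
      (fun d => (k d)%:R / d%:R : R) @ \oo --> rho].

End Threshold.

(* Main.v *)
(* By Farkas' lemma, for vectors [x_i] in general position whose positive hull is
   not [R^d], the [k]-faces correspond to the [k]-subsets [I] such that some linear
   functional vanishes on [x_i] for [i] in [I] and is positive on the other [x_i].
   Let [p Z Y] be the probability that some functional vanishes on [X_i] for [i] in
   [Z] and is positive for [i] in [Y]. Flipping the sign of [X_y] preserves the law
   and exchanges two events whose union is the event of [p Z Y] and whose
   intersection is that of [p (y |: Z) Y], hence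
   [2 * p Z (y |: Y) = p Z Y + p (y |: Z) Y], which determines [p] and gives the
   Cover-Efron formula for the expected face numbers.
   With [n = N - k - 1] and [m = d - k], the deficit is then [C(N, k)], divided by a
   quantity of order [2 ^ N], times a sum of [k] terms that decrease geometrically
   from the term of order [2 ^ k * C(n, m)] on, because [rho < 2 - 1 / delta].
   So it is comparable to [C(N, k) * C(N - k, d - k) / 2 ^ (N - k)], which is
   comparable to [exp (N * G) / N] by Stirling's formula. The limits follow from the
   sign of [G], obtained from the concavity of [G delta] and [G delta 1 > 0]; in the
   critical case [k / d] deviates from [rho] by slightly more than the square root
   of the error [G (d / N) rho], upwards for even and downwards for odd [d]. *)
Require Import Defs.
From HB Require Import structures.
From mathcomp Require Import all_boot all_order all_algebra.
From mathcomp Require Import all_classical all_reals all_analysis.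
From mathcomp Require Import measurable_realfun.
From mathcomp Require Import ring lra zify.
Set Implicit Arguments.
Unset Strict Implicit.
Unset Printing Implicit Defensive.
Import Order.TTheory GRing.Theory Num.Theory.
Import numFieldNormedType.Exports.
Local Open Scope classical_set_scope.
Local Open Scope ring_scope.

(** * Linear inequalities *)

(** The identities behind the recursion may fail for degenerate tuples, so they are stated for
    tuples in general position, an event of probability one. Sign patterns are open conditions that
    rational functionals can test; linear independence is recovered from them. The face count is not
    shown to be measurable in the tuple. The integral in the expectation is therefore a lower
    integral, computed by comparing the count, off a null set, with a finite sum of indicators. The
    event that the hull is proper does need measurability on all tuples; there a compactness
    argument is replaced by explicit bounds on coefficients. For the limits only rates matter: where
    the exponent is nonpositive the factor [1 / N] suffices, and where it is positive the
    fourth-order term of the exponential series does. In the critical case [G (d / N) rho] need not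
    vanish. Concavity turns a deviation [s] of [k / d] into a change of the exponent at least linear
    in [s], so a deviation of the order of the square root of the error dominates that error. *)

Definition dot {R : pzRingType} {d} (x : 'rV[R]_d) (u : 'cV[R]_d) : R := (x *m u) 0 0.

Section Dot.
Context {R : realFieldType} {d : nat}.
Implicit Types (x y : 'rV[R]_d) (u v : 'cV[R]_d).

Lemma dotDl x y u : dot (x + y) u = dot x u + dot y u.
Proof. by rewrite /dot mulmxDl mxE. Qed.

Lemma dotDr x u v : dot x (u + v) = dot x u + dot x v.
Proof. by rewrite /dot mulmxDr mxE. Qed.

Lemma dotZl a x u : dot (a *: x) u = a * dot x u.
Proof. by rewrite /dot -scalemxAl mxE. Qed.

Lemma dotZr a x u : dot x (a *: u) = a * dot x u.
Proof. by rewrite /dot -scalemxAr mxE. Qed.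

Lemma dotNl x u : dot (- x) u = - dot x u.
Proof. by rewrite -scaleN1r dotZl mulN1r. Qed.

Lemma dotNr x u : dot x (- u) = - dot x u.
Proof. by rewrite -scaleN1r dotZr mulN1r. Qed.

Lemma dot0l u : dot (0 : 'rV[R]_d) u = 0.
Proof. by rewrite /dot mul0mx mxE. Qed.

Lemma dot_suml (I : Type) (s : seq I) (P : pred I) (F : I -> 'rV[R]_d) u :
  dot (\sum_(i <- s | P i) F i) u = \sum_(i <- s | P i) dot (F i) u.
Proof. by rewrite /dot mulmx_suml summxE. Qed.

Lemma dot_eq0 x : (forall u, dot x u = 0) -> x = 0.
Proof.
move=> h; apply/rowP => j; rewrite mxE -(h (delta_mx j 0)) /dot.
by rewrite -colE mxE.
Qed.

Lemma dot_ge0_eq0 x : (forall u, 0 <= dot x u) -> x = 0.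
Proof.
move=> h; apply: dot_eq0 => u; apply/le_anti.
by rewrite h andbT -oppr_ge0 -dotNr h.
Qed.

(* Bartl's induction on the number of generators: if the first generator
   [x 0] is needed, some [u0] with [dot (x 0) u0 = -1] violates the conclusion,
   and adding suitable multiples of [x 0] makes all other vectors vanish at
   [u0] or not worse there. *)
Lemma farkas (n : nat) (x : 'I_n -> 'rV[R]_d) (y : 'rV[R]_d) :
  (forall u, (forall i, 0 <= dot (x i) u) -> 0 <= dot y u) ->
  exists2 c : 'I_n -> R, forall i, 0 <= c i & y = \sum_(i < n) c i *: x i.
Proof.
elim: n x y => [|n IH] x y h.
  exists (fun=> 0) => //; rewrite big_ord0; apply: dot_ge0_eq0 => u.
  by apply: h => -[].
have [hy|/existsNP[u0 /not_implyP[hu0 /negP]]] :=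
    pselect (forall u, (forall i, 0 <= dot (x (lift ord0 i)) u) -> 0 <= dot y u).
  have [c c0 ->] := IH (fun i => x (lift ord0 i)) y hy.
  exists (fun i => oapp c 0 (unlift ord0 i)).
    by move=> i; case: unlift => //=.
  rewrite big_ord_recl unlift_none scale0r add0r.
  by apply: eq_bigr => i _; rewrite liftK.
rewrite -ltNge => yu0.
have x0u0 : dot (x ord0) u0 < 0.
  rewrite ltNge; apply/negP => x0u0.
  have : 0 <= dot y u0.
    apply: h => i; case: (unliftP ord0 i) => [j ->|->] //.
  by rewrite leNgt yu0.
pose u1 := (- dot (x ord0) u0)^-1 *: u0.
have xu1 : dot (x ord0) u1 = -1.
  by rewrite /u1 dotZr invrN mulNr mulVf// lt_eqF.
have xu1' i : 0 <= dot (x (lift ord0 i)) u1.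
  by rewrite /u1 dotZr mulr_ge0// invr_ge0 oppr_ge0 ltW.
have yu1 : dot y u1 < 0.
  by rewrite /u1 dotZr pmulr_rlt0// invr_gt0 oppr_gt0.
clearbody u1.
pose f z := z + dot z u1 *: x ord0.
have [|c c0 yE] := IH (fun i => f (x (lift ord0 i))) (f y).
  (* The adjoint of the projection [f]: the functional on the right vanishes at [x ord0], so only
     the other generators have to be tested. *)
  move=> u hu; have fE z : dot (f z) u = dot z (u + dot (x ord0) u *: u1).
    by rewrite /f dotDl dotZl dotDr dotZr mulrC.
  rewrite fE; apply: h => i; case: (unliftP ord0 i) => [j ->|->].
    by rewrite -fE.
  by rewrite dotDr dotZr xu1 mulrN1 subrr.
pose a := \sum_i c i * dot (x (lift ord0 i)) u1 - dot y u1.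
have a0 : 0 <= a.
  rewrite subr_ge0 (le_trans (ltW yu1))//.
  by apply: sumr_ge0 => j _; apply: mulr_ge0.
exists (fun i => oapp c a (unlift ord0 i)); first by move=> i; case: unlift.
rewrite big_ord_recl unlift_none.
under eq_bigr do rewrite liftK.
rewrite /=; have -> : y = f y - dot y u1 *: x ord0 by rewrite /f addrK.
rewrite yE /a scalerBl scaler_suml [in LHS](eq_bigr _ (fun i _ => scalerDr _ _ _)).
rewrite big_split -addrA addrC; congr (_ - _ + _).
by apply: eq_bigr => i _; rewrite scalerA.
Qed.

Lemma exists_orthogonal (K : finType) (I : {set K}) (x : K -> 'rV[R]_d) :
  (#|I| < d)%N -> exists2 v, v != 0 & forall i, i \in I -> dot (x i) v = 0.
Proof.
move=> Id; pose M := \matrix_(i < #|I|) x (enum_val i).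
have /matrix0Pn[a [b ab]] : cokermx M != 0.
  by rewrite -mxrank_eq0 mxrank_coker subn_eq0 -ltnNge (leq_ltn_trans (rank_leq_row M)).
exists (col b (cokermx M)).
  by apply/eqP => /colP/(_ a); rewrite mxE [RHS]mxE; move/eqP: ab.
move=> i iI; have xM : x i *m cokermx M = 0.
  have := congr1 (fun A => row (enum_rank_in iI i) A) (mulmx_coker M).
  by rewrite row_mul rowK enum_rankK_in// row0.
by rewrite /dot colE mulmxA xM mul0mx mxE.
Qed.

End Dot.

(** * General position *)

(** Strict inequalities at finitely many vectors survive a small change of the functional. The [1 +]
    in the denominators avoids division by zero. *)
Lemma exists_small_step {R : realFieldType} (I : finType) (P : pred I) (a b : I -> R) :
  (forall i, P i -> 0 < a i) ->
  exists2 t, 0 < t & forall i, P i -> 0 < a i + t * b i.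
Proof.
move=> a0; pose t := \big[Num.min/1]_(i | P i) (a i / (1 + `|b i|)).
have b1 i : 0 < 1 + `|b i| by rewrite ltr_pwDl.
exists t.
  by rewrite /t; elim/big_ind: _ => // [x y x0 y0|i Pi]; rewrite ?lt_min ?x0// divr_gt0 ?a0.
move=> i Pi; have t_le : t <= a i / (1 + `|b i|).
  by rewrite /t (bigD1 i)//= ge_min lexx.
have t0 : 0 < t.
  by rewrite /t; elim/big_ind: _ => // [x y x0 y0|j Pj]; rewrite ?lt_min ?x0// divr_gt0 ?a0.
move: t_le; rewrite ler_pdivlMr// => t_le.
have := ler_norm (- b i); rewrite normrN => bi.
have : t * - b i <= t * `|b i| by rewrite ler_pM2l.
lra.
Qed.

Section GeneralPosition.
Context {R : realType} {d N : nat}.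
Implicit Types (x : 'I_N -> 'rV[R]_d) (Z Y I J : {set 'I_N}) (u v : 'cV[R]_d).

Definition flip J x : 'I_N -> 'rV[R]_d := fun i => if i \in J then - x i else x i.

(** The event whose probability is [p Z Y]. *)
Definition sep Z Y : set ('I_N -> 'rV[R]_d) :=
  [set x | exists u, (forall i, i \in Z -> dot (x i) u = 0) /\
                     (forall i, i \in Y -> 0 < dot (x i) u)].

(* Any at most d of the vectors are linearly independent, expressed through
   the sign patterns realized on them because these are easily measurable. *)
Definition general_position : set ('I_N -> 'rV[R]_d) :=
  [set x | forall I J, (#|I| <= d)%N -> sep finset.set0 I (flip J x)].

Lemma dot_flip J x i u : dot (flip J x i) u = (-1) ^+ (i \in J) * dot (x i) u.
Proof. by rewrite /flip; case: ifP; rewrite ?dotNl ?mulN1r ?mul1r. Qed.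

Lemma flip_flip J J' x : flip J (flip J' x) = flip ((J :\: J') :|: (J' :\: J)) x.
Proof.
apply/funext => i; rewrite /flip !inE.
by case: (i \in J); case: (i \in J'); rewrite /= ?opprK.
Qed.

Lemma flipK J : involutive (flip J).
Proof.
by move=> x; apply/funext => i; rewrite /flip; case: (i \in J); rewrite ?opprK.
Qed.

Lemma general_position_flip J x : general_position x -> general_position (flip J x).
Proof. by move=> gx I J' Id; rewrite flip_flip; apply: gx. Qed.

Lemma sep_combine Z Y y x : y \notin Z -> y \notin Y ->
  sep Z (y |: Y) x -> sep Z (y |: Y) (flip [set y]%SET x) -> sep (y |: Z) Y x.
Proof.
move=> yZ yY [u [uZ uY]] [v [vZ vY]].
have neq i : (i != y) -> dot (flip [set y]%SET x i) v = dot (x i) v.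
  by move=> /negPf iy; rewrite dot_flip inE iy mul1r.
have uy : 0 < dot (x y) u by apply: uY; rewrite !inE eqxx.
have vy : 0 < - dot (x y) v.
  by have := vY y; rewrite dot_flip !inE eqxx mulN1r; apply.
(* Positive weights chosen so that the values of [u] and [v] at [x y], which have opposite signs,
   cancel. *)
exists (- dot (x y) v *: u + dot (x y) u *: v); split=> i.
  rewrite !inE dotDr !dotZr => /predU1P[->|iZ]; first by ring.
  have iy : i != y by apply: contraNneq yZ => <-.
  by rewrite (uZ i iZ) -(neq i iy) vZ// !mulr0 addr0.
move=> iY; have iy : i != y by apply: contraNneq yY => <-.
rewrite dotDr !dotZr addr_gt0// mulr_gt0//.
  by apply: uY; rewrite !inE iY orbT.
by rewrite -(neq i iy); apply: vY; rewrite !inE iY orbT.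
Qed.

(** Induction on [#|Z|]: for [y] in [Z] both signs at [y] can be realized, and [sep_combine] mixes
    them into a zero. *)
Lemma general_position_sep Z Y x : general_position x ->
  [disjoint Z & Y]%B -> (#|Z| + #|Y| <= d)%N -> sep Z Y x.
Proof.
move nE : #|Z| => n; elim: n Z Y nE x => [|n IH] Z Y nE x gx ZY le.
  have -> : Z = finset.set0 by apply/eqP; rewrite -cards_eq0 nE.
  have -> : x = flip finset.set0 x by apply/funext => i; rewrite /flip inE.
  exact: gx.
have [y yZ] : exists y, y \in Z by apply/set0Pn; rewrite -card_gt0 nE.
have yY : y \notin Y by rewrite (disjointFr ZY).
have Zy : #|Z :\ y| = n by move: nE; rewrite (cardsD1 y Z) yZ add1n => -[].
have h : [disjoint Z :\ y & y |: Y]%B.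
  rewrite finset.disjoints_subset; apply/fintype.subsetP => i; rewrite !inE => /andP[iy iZ].
  by rewrite (negPf iy)/= (disjointFr ZY).
have hc : (n + #|y |: Y| <= d)%N by rewrite cardsU1 yY addnA addn1.
rewrite -(finset.setD1K yZ); apply: sep_combine => //; first by rewrite !inE eqxx.
  exact: IH.
by apply: IH => //; apply: general_position_flip.
Qed.

Section Extend.
Variables (Z Y : {set 'I_N}) (y : 'I_N).
Hypotheses (yZ : y \notin Z) (yY : y \notin Y).
Hypothesis Zd : (#|Z| < d)%N.

(** As [#|Z| < d], some [v] vanishes on [Z] and is positive at [y]; a small multiple of it is added
    to [u]. *)
Lemma sep_perturb x : general_position x -> sep (y |: Z) Y x -> sep Z (y |: Y) x.
Proof.
move=> gx [u [uZ uY]].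
have [||v [vZ vy]] := @general_position_sep Z [set y]%SET x gx.
- by rewrite disjoint_sym disjoints1.
- by rewrite cards1 addn1.
have [t t0 ht] := @exists_small_step R _ (mem Y) (fun i => dot (x i) u) (fun i => dot (x
  i) v) uY.
exists (u + t *: v); split=> i.
  by move=> iZ; rewrite dotDr dotZr uZ ?inE ?iZ ?orbT// vZ// mulr0 addr0.
rewrite !inE dotDr dotZr => /predU1P[->|iY]; last exact: ht.
by rewrite uZ ?inE ?eqxx// add0r mulr_gt0// vy// inE.
Qed.

Lemma sep_setU x : general_position x ->
  sep Z Y x <-> sep Z (y |: Y) x \/ sep Z (y |: Y) (flip [set y]%SET x).
Proof.
have neq u i z : (i != y) -> dot (flip [set y]%SET z i) u = dot (z i) u.
  by move=> /negPf iy; rewrite dot_flip inE iy mul1r.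
have yn i (A : {set 'I_N}) : y \notin A -> i \in A -> i != y.
  by move=> yA iA; apply: contraNneq yA => <-.
move=> gx; split=> [[u [uZ uY]]|[[u [uZ uY]]|[u [uZ uY]]]].
- have [uy|uy|uy] := ltgtP 0 (dot (x y) u).
  + by left; exists u; split=> // i; rewrite !inE => /predU1P[->//|]; apply: uY.
  + right; exists u; split=> i; first by move=> iZ; rewrite neq ?uZ// (yn _ Z).
    rewrite !inE => /predU1P[->|iY].
      by rewrite dot_flip inE eqxx mulN1r oppr_gt0.
    by rewrite neq ?uY// (yn _ Y).
  + left; apply: sep_perturb => //; exists u; split=> // i.
    by rewrite !inE => /predU1P[->//|]; apply: uZ.
- by exists u; split=> // i iY; apply: uY; rewrite !inE iY orbT.
- exists u; split=> i iA; first by rewrite -(neq _ _ _ (yn _ _ yZ iA)) uZ.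
  by rewrite -(neq _ _ _ (yn _ _ yY iA)) uY// !inE iA orbT.
Qed.

Lemma sep_setI x : general_position x ->
  sep (y |: Z) Y x <-> sep Z (y |: Y) x /\ sep Z (y |: Y) (flip [set y]%SET x).
Proof.
move=> gx; split=> [sx|[]]; last exact: sep_combine.
split; first exact: sep_perturb.
apply: sep_perturb; first exact: general_position_flip.
have [u [uZ uY]] := sx; exists u; split=> i iA; rewrite dot_flip.
  by rewrite uZ// mulr0.
by rewrite inE (_ : (i == y) = false) ?mul1r ?uY//; apply: contraNF yY => /eqP<-.
Qed.

End Extend.

(** The relation is tested against a functional that vanishes on [I :\ i] and is positive at [i]. *)
Lemma general_position_free I (c : 'I_N -> R) x : general_position x -> (#|I| <= d)%N ->
  \sum_(i in I) c i *: x i = 0 -> forall i, i \in I -> c i = 0.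
Proof.
move=> gx Id cx i iI.
have [||u [uZ ui]] := @general_position_sep (I :\ i) [set i]%SET x gx.
- by rewrite disjoint_sym disjoints1 !inE eqxx.
- by rewrite cards1 addn1 -[X in (X <= _)%N]add1n; move: Id; rewrite (cardsD1 i) iI.
have : dot (\sum_(i in I) c i *: x i) u = 0 by rewrite cx dot0l.
rewrite dot_suml (bigD1 i)//= big1 ?addr0 => [|j /andP[jI ji]].
  by move/eqP; rewrite dotZl mulf_eq0 => /orP[/eqP//|/eqP ui0]; move: (ui i);
    rewrite ui0 inE eqxx ltxx => /(_ isT).
by rewrite dotZl uZ ?mulr0// !inE ji.
Qed.

Lemma free_general_position I x : general_position x -> (#|I| <= d)%N ->
  free [seq x i | i <- enum I].
Proof.
move=> gx Id; apply/(@freeP _ _ _ (map_tuple x (enum_tuple (mem I)))) => k hk i0.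
pose c j := k (enum_rank_in (enum_valP i0) j).
have cE i : c (enum_val i) = k i by rewrite /c enum_valK_in.
rewrite -cE; apply: (general_position_free gx Id _ (enum_valP i0)).
rewrite big_enum_val -[RHS]hk; apply: eq_bigr => i _.
rewrite cE; congr (_ *: _).
by rewrite (nth_map (enum_val i)) ?size_enum_ord -?cardE// -enum_val_nth.
Qed.

Lemma general_position_orthogonal I u x : general_position x -> #|I| = d ->
  (forall i, i \in I -> dot (x i) u = 0) -> u = 0.
Proof.
move=> gx Id uI; set X := [seq x i | i <- enum I].
have bX : basis_of fullv X.
  by rewrite basisEfree free_general_position ?Id// subvf/= dimvf /dim/= mul1n size_map
    -cardE Id.
have h y : dot y u = 0.
  rewrite (coord_basis (X := in_tuple X) bX (memvf y)) dot_suml big1// => i _.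
  rewrite dotZl; have /mapP[j] := mem_nth 0 (ltn_ord i : (i < size (in_tuple X))%N).
  by rewrite mem_enum => jI ->; rewrite uI// mulr0.
apply/colP => j; rewrite mxE -(h (delta_mx 0 j)) /dot -rowE mxE//.
Qed.

(** Farkas' lemma applied to a point outside the hull; conversely, testing the functional at both
    signs of each basis vector shows that it would vanish. *)
Lemma positive_hull_proper x :
  positive_hull x <> setT <-> exists2 u, u != 0 & forall i, 0 <= dot (x i) u.
Proof.
split.
  move=> hx; have [y hy] : exists y, ~ positive_hull x y.
    by apply: contrapT => h; apply: hx; apply/seteqP; split=> // y _;
      apply: contrapT => hy; apply: h; exists y.
  have /existsNP[u /not_implyP[hu /negP]] : ~ forall u, (forall i, 0 <= dot (x i) u) -> 0
    <= dot y u.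
    by move=> /farkas[c c0 yE]; apply: hy; exists c.
  rewrite -ltNge => yu; exists u => //.
  by apply: contraTneq yu => ->; rewrite /dot mulmx0 mxE ltxx.
move=> [u u0 hu] hx; move/eqP: u0; apply; apply/colP => j; rewrite mxE.
have h y : 0 <= dot y u.
  have : positive_hull x y by rewrite hx.
  by case=> c c0 ->; rewrite dot_suml sumr_ge0// => i _; rewrite dotZl mulr_ge0.
have uj : dot (delta_mx 0 j) u = u j 0 by rewrite /dot -rowE mxE.
apply/le_anti; rewrite -uj h andbT -oppr_ge0 -dotNl; exact: h.
Qed.

Lemma positive_hull_proper_general x : (0 < N)%N ->
  general_position x ->
  positive_hull x <> setT <-> sep finset.set0 (~: finset.set0) x.
Proof.
move=> N0 gx; split=> [/positive_hull_proper[u u0 hu]|[u [_ uY]]].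
  (* A nonzero functional vanishes on fewer than [d] of the vectors, so it can be perturbed to be
     positive on these as well. *)
  pose Z := [set i | dot (x i) u == 0]%SET.
  have Zd : (#|Z| < d)%N.
    rewrite ltnNge; apply/negP => dZ.
    have /card_geqP[s [us ss sZ]] := dZ; move/eqP: u0; apply.
    apply: (@general_position_orthogonal [set i in s]%SET u x gx).
      by rewrite cardsE -ss; apply/card_uniqP.
    by move=> i; rewrite inE => /sZ; rewrite inE => /eqP.
  have [||v [_ vZ]] := @general_position_sep finset.set0 Z x gx.
  - by rewrite finset.disjoints_subset finset.sub0set.
  - by rewrite cards0 add0n ltnW.
  have uZ i : i \notin Z -> 0 < dot (x i) u by rewrite inE lt_neqAle eq_sym hu andbT.
  have [t t0 ht] := exists_small_step (fun i => dot (x i) v) uZ.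
  exists (u + t *: v); split=> i; first by rewrite inE.
  move=> _; have [iZ|] := boolP (i \in Z); rewrite dotDr dotZr; last exact: ht.
  by move: (iZ); rewrite inE => /eqP ->; rewrite add0r mulr_gt0// vZ.
have h i : 0 < dot (x i) u by apply: uY; rewrite !inE.
apply/positive_hull_proper; exists u => [|i]; last exact: ltW.
by apply: contraTneq (h (Ordinal N0)) => ->; rewrite /dot mulmx0 mxE ltxx.
Qed.

End GeneralPosition.

(** * Faces of polyhedral cones *)

Lemma counting_image (R : realType) (T : finType) (U : choiceType) (f : T -> U) (A : {set T}) :
  {in A &, injective f} ->
  counting (f @` [set` A]) = (#|A|%:R%:E : \bar R).
Proof.
move=> finj; have fA : finite_set (f @` [set` A]).
  by apply: finite_image; exact: finite_finset.
rewrite /counting asboolT// [#|A|]cardE -(size_map f); congr (_%:R%:E).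
apply: perm_size; apply: uniq_perm; first exact: finmap.fset_uniq.
  rewrite map_inj_in_uniq ?enum_uniq// => i j; rewrite !mem_enum; exact: finj.
move=> y; rewrite in_fset_set//; apply/idP/mapP.
  by rewrite inE => -[i iA <-]; exists i; rewrite ?mem_enum.
by move=> [i + ->]; rewrite mem_enum inE => iA; exists i.
Qed.

Lemma convex_setP_lmod (R : numFieldType) (E : lmodType R) (A : set E) :
  convex_set (A : set (convex_lmodType E)) <->
  forall x y t, 0 <= t <= 1 -> A x -> A y -> A (t *: x + (1 - t) *: y).
Proof.
split=> [cA x y t /andP[t0 t1] Ax Ay|cA x y t].
  by have /(_ (Itv01 t0 t1)) := cA x y _ (mem_set Ax) (mem_set Ay); rewrite inE.
rewrite !inE => Ax Ay; apply: (cA x y t%:num) => //.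
by apply/andP; split.
Qed.

Section Faces.
Context {R : realType} {d N : nat}.
Implicit Types (x : 'I_N -> 'rV[R]_d) (I J : {set 'I_N}) (C F : set 'rV[R]_d).

Definition subcone x I : set 'rV[R]_d :=
  [set y | exists2 c : 'I_N -> R, forall i, 0 <= c i & y = \sum_(i in I) c i *: x i].

Definition convex_cone C : Prop :=
  [/\ C 0, forall y z, C y -> C z -> C (y + z) & forall a y, 0 <= a -> C y -> C (a *: y)].

Lemma convex_cone_sum C (K : Type) (s : seq K) (P : pred K) (a : K -> R) (y : K -> 'rV[R]_d) :
  convex_cone C -> (forall i, P i -> 0 <= a i) -> (forall i, P i -> C (y i)) ->
  C (\sum_(i <- s | P i) a i *: y i).
Proof.
move=> [C0 CD CZ] a0 Cy; elim/big_ind: _ => // i Pi.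
by apply: CZ; [exact: a0|exact: Cy].
Qed.

Lemma subcone_convex_cone x I : convex_cone (subcone x I).
Proof.
split.
- exists (fun=> 0) => //; rewrite big1// => i _; exact: scale0r.
- move=> _ _ [a a0 ->] [b b0 ->]; exists (fun i => a i + b i) => [i|].
    exact: addr_ge0.
  by rewrite -big_split; apply: eq_bigr => i _; rewrite scalerDl.
- move=> t _ t0 [a a0 ->]; exists (fun i => t * a i) => [i|]; first exact: mulr_ge0.
  by rewrite scaler_sumr; apply: eq_bigr => i _; rewrite scalerA.
Qed.

Lemma positive_hullE x : positive_hull x = subcone x (~: finset.set0).
Proof.
apply/seteqP; split=> y [c c0 ->]; exists c => //; apply: eq_bigl => i; rewrite !inE//.
Qed.

Lemma subcone_gen x I i : i \in I -> subcone x I (x i).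
Proof.
move=> iI; exists (fun j => (j == i)%:R) => //.
rewrite (bigD1 i)//= eqxx scale1r big1 ?addr0// => j /andP[_ /negPf ->].
exact: scale0r.
Qed.

Lemma subcone_sub x I J : I \subset J -> subcone x I `<=` subcone x J.
Proof.
move=> /fintype.subsetP IJ y [c c0 ->].
apply: convex_cone_sum => //; first exact: subcone_convex_cone.
by move=> i /IJ; apply: subcone_gen.
Qed.

Section FaceOfCone.
Variables (C F : set 'rV[R]_d).
Hypotheses (coneC : convex_cone C) (faceF : is_face C F).

Let scale_half (y : 'rV[R]_d) : 2^-1 *: (2 *: y) = y.
Proof. by rewrite scalerA mulVf ?scale1r// pnatr_eq0. Qed.

Let half_compl : 1 - 2^-1 = 2^-1 :> R.
Proof. by lra. Qed.

Lemma face_cone : convex_cone F.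
Proof.
have [C0 CD CZ] := coneC; have [[z Fz] FC /convex_setP_lmod cF eF] := faceF.
(* The point [y] lies on the segment from 0 to [s^-1 *: y], so extremality puts both end points into
   [F]. This gives dilations by factors above 1; convexity with 0 gives the others. *)
have h y s : 0 < s < 1 -> F y -> F 0 /\ F (s^-1 *: y).
  move=> /andP[s0 s1] Fy; apply: (eF _ _ s) => //; last 2 first.
  - by rewrite s0.
  - by rewrite scaler0 add0r scalerA mulfV ?scale1r// gt_eqF.
  by apply: CZ; [rewrite invr_ge0 ltW|exact: FC].
have half : 0 < (2^-1 : R) < 1 by lra.
have F0 : F 0 by have [] := h z 2^-1 half Fz.
have FZ a y : 0 <= a -> F y -> F (a *: y).
  move=> a0 Fy; have [a1|a1] := leP a 1.
    have -> : a *: y = a *: y + (1 - a) *: 0 by rewrite scaler0 addr0.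
    by apply: cF => //; rewrite a0.
  have [|_] := h y a^-1 _ Fy; last by rewrite invrK.
  by rewrite invr_gt0 invf_lt1 ?(lt_trans ltr01)// a1.
split=> // y w Fy Fw.
have -> : y + w = 2^-1 *: (2 *: y) + (1 - 2^-1) *: (2 *: w).
  by rewrite half_compl !scale_half.
by apply: cF; [lra|exact: FZ|exact: FZ].
Qed.

Lemma face_addl y z : C y -> C z -> F (y + z) -> F y.
Proof.
have [C0 CD CZ] := coneC; have [_ FC _ eF] := faceF; have [F0 FD FZ] := face_cone.
move=> Cy Cz Fyz; have [||||+ _] := eF (2 *: y) (2 *: z) 2^-1.
- exact: CZ.
- exact: CZ.
- by lra.
- by rewrite half_compl !scale_half.
by move=> /(FZ 2^-1); rewrite scalerA mulVf ?scale1r//; apply.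
Qed.

End FaceOfCone.

Lemma subcone_face x I u : (forall i, i \in I -> dot (x i) u = 0) ->
  (forall i, i \in ~: I -> 0 < dot (x i) u) -> is_face (positive_hull x) (subcone x I).
Proof.
move=> uI uI'.
have u0 y : positive_hull x y -> 0 <= dot y u.
  move=> [c c0 ->]; rewrite dot_suml sumr_ge0// => i _; rewrite dotZl mulr_ge0//.
  by have [iI|iI] := boolP (i \in I); [rewrite uI|rewrite ltW// uI'// inE].
(* The subcone is the part of the hull where [u], nonnegative on the hull, attains 0. *)
have subE y : subcone x I y <-> positive_hull x y /\ dot y u = 0.
  split=> [[c c0 ->]|[[c c0 ->]] hc].
    split; first by rewrite positive_hullE; apply: (@subcone_sub x I);
      [rewrite finset.setC0 finset.subsetT|exists c].
    by rewrite dot_suml big1// => i iI; rewrite dotZl uI// mulr0.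
  exists c => //; rewrite [LHS](bigID (mem I))/= [X in _ + X]big1 ?addr0// => i iI.
  move: hc; rewrite dot_suml => /eqP; rewrite psumr_eq0 => [/allP/(_ i)|j _]; last first.
    by rewrite dotZl mulr_ge0//; have [jI|jI] := boolP (j \in I);
      [rewrite uI|rewrite ltW// uI'// inE].
  rewrite mem_index_enum => /(_ isT) /=; rewrite dotZl mulf_eq0 => /orP[/eqP->|/eqP ui].
    exact: scale0r.
  by have := uI' i; rewrite inE iI ui ltxx => /(_ isT).
have [S0 SD SZ] := subcone_convex_cone x I.
split.
- by exists 0.
- by move=> y /subE[].
- apply/convex_setP_lmod => y z t /andP[t0 t1] Sy Sz.
  by apply: SD; apply: SZ => //; rewrite subr_ge0.
- move=> y z t Cy Cz /andP[t0 t1] /subE[_]; rewrite dotDl !dotZl => /eqP.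
  have [uy uz] := (u0 y Cy, u0 z Cz).
  rewrite paddr_eq0 ?mulr_ge0 ?subr_ge0 ?(ltW t1) ?(ltW t0)//.
  rewrite !mulf_eq0 subr_eq0 (gt_eqF t1) (gt_eqF t0)/= => /andP[/eqP y0 /eqP z0].
  by split; apply/subE.
Qed.

Lemma subcone_dim x I : general_position x -> (#|I| <= d)%N -> has_dim (subcone x I) #|I|.
Proof.
move=> gx Id; exists <<[seq x i | i <- enum I]>>%VS; split.
- move=> y [c c0 ->] /=; apply: memv_suml => i iI; apply: memvZ; apply: memv_span.
  by apply: map_f; rewrite mem_enum.
- move=> W SW; apply/span_subvP => y /mapP[i]; rewrite mem_enum => iI ->.
  exact: SW (subcone_gen x iI).
- by have /eqP := free_general_position gx Id; rewrite size_map -cardE.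
Qed.

(** If a point of [F] is a nonnegative combination of the generators, extremality puts every
    generator with a positive coefficient into [F]. *)
Lemma face_eq_subcone x F : is_face (positive_hull x) F ->
  F = subcone x [set i | `[< F (x i) >]]%SET.
Proof.
move=> fF; have coneC : convex_cone (positive_hull x).
  by rewrite positive_hullE; exact: subcone_convex_cone.
have coneF := face_cone coneC fF; have [_ FC _ _] := fF.
have Cx i : positive_hull x (x i) by rewrite positive_hullE; apply: subcone_gen; rewrite !inE.
apply/seteqP; split=> y; last first.
  by move=> [c c0 ->]; apply: convex_cone_sum => // i; rewrite inE => /asboolP.
move=> Fy; have [c c0 yE] := FC _ Fy.
exists c => //; rewrite yE [LHS](bigID (fun i => i \in [set i | `[< F (x i) >]]%SET)) /=.
rewrite [X in _ + X]big1 ?addr0// => i; rewrite inE => /asboolPn iF.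
have [->|ci0] := eqVneq (c i) 0; first exact: scale0r.
exfalso; apply: iF.
have [F0 FD FZ] := coneF.
have : F (c i *: x i).
  apply: (face_addl coneC fF (z := \sum_(j | j != i) c j *: x j)).
  - by have [_ _] := coneC; apply.
  - by apply: convex_cone_sum.
  - by move: Fy; rewrite yE (bigD1 i).
by move=> /(FZ (c i)^-1); rewrite scalerA mulVf// scale1r invr_ge0; apply.
Qed.

(* Farkas' lemma, with [- \sum_(j in I) x j] as an additional generator to
   force the functional to vanish on the face. *)
Lemma face_exposed x F : is_face (positive_hull x) F ->
  let I := [set i | `[< F (x i) >]]%SET in sep I (~: I) x.
Proof.
move=> fF I; have coneC : convex_cone (positive_hull x).
  by rewrite positive_hullE; exact: subcone_convex_cone.
have coneF := face_cone coneC fF; have [_ FC _ _] := fF.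
have Cx i : positive_hull x (x i) by rewrite positive_hullE; apply: subcone_gen; rewrite !inE.
have h j : exists u, [/\ forall i, i \in I -> dot (x i) u = 0, forall i, 0 <= dot (x i) u &
    j \notin I -> 0 < dot (x j) u].
  have [jI|jI] := boolP (j \in I).
    by exists 0; split=> // i *; rewrite /dot mulmx0 mxE.
  pose z := - \sum_(i in I) x i.
  have /existsNP[u /not_implyP[hu /negP]] : ~ forall u,
      (forall i, 0 <= dot (oapp x z (unlift (@ord0 N) i)) u) -> 0 <= dot (- x j) u.
    (* Otherwise [x j] plus a point of the cone would be a multiple of the sum over [I], which is in
       [F]; extremality would then give [j \in I]. *)
    move=> /farkas[c c0]; rewrite big_ord_recl unlift_none.
    under eq_bigr do rewrite liftK.
    rewrite /= /z scalerN => /eqP; rewrite addrC eq_sym subr_eq => /eqP hc.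
    move: jI; rewrite inE => /asboolPn; apply.
    apply: (face_addl coneC fF (z := \sum_i c (lift ord0 i) *: x i)) => //.
      exact: convex_cone_sum.
    rewrite hc addNKr scaler_sumr.
    by apply: convex_cone_sum => // i; rewrite inE => /asboolP.
  rewrite -ltNge dotNl oppr_lt0 => uj.
  have ui i : 0 <= dot (x i) u by have := hu (lift ord0 i); rewrite liftK.
  exists u; split=> // i iI.
  have := hu ord0; rewrite unlift_none /= /z dotNl oppr_ge0 dot_suml => hs.
  have /eqP : \sum_(i in I) dot (x i) u = 0 by apply/le_anti; rewrite hs sumr_ge0.
  by rewrite psumr_eq0// => /allP/(_ i); rewrite mem_index_enum iI => /(_ isT)/eqP.
(* Each [u j] handles a single [j]; as all are nonnegative on the generators, their sum handles all
   [j] at once. *)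
have /choice[u hu] := h; exists (\sum_j u j); split=> i.
  move=> iI; rewrite /dot mulmx_sumr summxE big1// => j _.
  by have [+ _ _] := hu j; exact.
rewrite inE => iI; rewrite /dot mulmx_sumr summxE (bigD1 i)//= ltr_pwDl//.
  by have [_ _] := hu i; exact.
by apply: sumr_ge0 => j _; have [_ + _] := hu j; exact.
Qed.

Lemma has_dim_le F F' m n : F `<=` F' -> has_dim F m -> has_dim F' n -> (m <= n)%N.
Proof.
move=> FF' [U [_ minU <-]] [U' [FU' _ <-]].
by apply: dimvS; apply: minU; apply: subset_trans FU'.
Qed.

(** Recovers [I] from its subcone, so that counting faces amounts to counting index sets. *)
Lemma sep_subcone_mem x I i : sep I (~: I) x -> subcone x I (x i) -> i \in I.
Proof.
move=> [u [uI uI']] [c _ xi]; apply: contraT => iI.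
have : 0 < dot (x i) u by apply: uI'; rewrite inE.
by rewrite xi dot_suml big1 ?ltxx// => j jI; rewrite dotZl uI// mulr0.
Qed.

Lemma face_number_general x k : general_position x -> (0 < k < d)%N ->
  face_number (positive_hull x) k =
  (#|[set I : {set 'I_N} | (#|I| == k) && `[< sep I (~: I) x >]]%SET|%:R%:E)%E.
Proof.
move=> gx /andP[k0 kd]; rewrite /face_number -(counting_image R (f := subcone x)).
  congr counting; apply/seteqP; split=> F /=.
    move=> [fF dF]; have sx := face_exposed fF; have FE := face_eq_subcone fF.
    move: sx FE; set I := [set i | _]%SET => /= sx FE; exists I => //.
    rewrite inE; apply/andP; split; last exact/asboolP.
    have [Id|dI] := leqP #|I| d.
      have := subcone_dim gx Id; rewrite -FE => dF'.
      by rewrite eqn_leq !(has_dim_le (@subset_refl _ F) _ _).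
    (* With more than [d] generators on the face, [d] of them are independent, so its dimension
       would be at least [d > k]. *)
    have /card_geqP[s [us ss sI]] := ltnW dI.
    have sd : #|[set i in s]%SET| = d by rewrite cardsE -ss; apply/card_uniqP.
    have := subcone_dim gx (eq_leq sd); rewrite sd => dF'.
    have : (d <= k)%N.
      apply: has_dim_le dF' dF; rewrite FE; apply: subcone_sub.
      by apply/fintype.subsetP => i; rewrite inE => /sI.
    by rewrite leqNgt kd.
  move=> [I]; rewrite inE => /andP[/eqP Ik /asboolP sx] <-; split.
    by have [u [uI uI']] := sx; apply: subcone_face uI uI'.
  by rewrite -Ik; apply: subcone_dim => //; rewrite Ik ltnW.
move=> I J; rewrite !inE => /andP[_ /asboolP sI] /andP[_ /asboolP sJ] IJ.
apply/setP => i; apply/idP/idP => iI.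
  by apply: (sep_subcone_mem sJ); rewrite -IJ; apply: subcone_gen.
by apply: (sep_subcone_mem sI); rewrite IJ; apply: subcone_gen.
Qed.

End Faces.

(** * The law of a tuple of random vectors *)

Section TupleSpace.
Context (R : realType) (d N : nat).

Definition rectangle (B : 'I_N -> set (borel_rV R d)) : set ('I_N -> borel_rV R d) :=
  [set x | forall i, B i (x i)].

Definition rectangles : set (set ('I_N -> borel_rV R d)) :=
  [set A | exists2 B, (forall i, measurable (B i)) & A = rectangle B].

(** The product sigma-algebra, generated by a family closed under intersection so that laws are
    determined on rectangles. *)
Definition tuple_rV := g_sigma_algebraType rectangles.

Lemma rectangles_setI : setI_closed rectangles.
Proof.
move=> _ _ [A mA ->] [B mB ->]; exists (fun i => A i `&` B i).
  by move=> i; apply: measurableI.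
apply/seteqP; split=> x /=; first by move=> [xA xB] i; split; [exact: xA|exact: xB].
by move=> xAB; split=> i; have [] := xAB i.
Qed.

Lemma measurable_rectangle B : (forall i, measurable (B i)) ->
  measurable (rectangle B : set tuple_rV).
Proof. by move=> mB; apply: sub_sigma_algebra; exists B. Qed.

Lemma tuple_measure_unique (m1 : probability tuple_rV R) (m2 : {measure set tuple_rV ->
  \bar R}) :
  (forall B, (forall i, measurable (B i)) -> m1 (rectangle B) = m2 (rectangle B)) ->
  forall A, measurable A -> m1 A = m2 A.
Proof.
move=> m12 A mA; apply: (@measure_unique _ R tuple_rV rectangles (fun=> setT) _ _ _ _ m1
  m2) => //.
- exact: rectangles_setI.
- by move=> _; exists (fun=> setT) => //; apply/seteqP; split.
- by rewrite bigcup_const//; exists 0%N.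
- by move=> _ [B mB ->]; apply: m12.
- by move=> _; rewrite (le_lt_trans (probability_le1 _ _))// ltry.
Qed.

Lemma measurable_fun_tuple d' (T : measurableType d') (f : T -> tuple_rV) :
  (forall i, measurable_fun setT (fun w => f w i : borel_rV R d)) ->
  measurable_fun setT f.
Proof.
move=> mf; apply: (@measurability _ _ T tuple_rV setT f rectangles) => // _ [_ [B mB ->] <-].
rewrite setTI (_ : _ @^-1` _ = \bigcap_(i in [set: 'I_N]) (fun w => f w i) @^-1` B i).
  apply: fin_bigcap_measurable => [|i _]; first exact: finite_finset;
    rewrite -[X in measurable X]setTI.
  exact: mf.
by apply/seteqP; split=> w h i; move: (h i) => //; apply.
Qed.

Lemma measurable_coordinate i : measurable_fun setT (fun x : tuple_rV => x i : borel_rV R d).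
Proof.
move=> _ B mB; rewrite setTI.
rewrite (_ : _ @^-1` _ = rectangle (fun j => if j == i then B else setT)).
  by apply: measurable_rectangle => j; case: ifP.
apply/seteqP; split=> x /= h; last by have := h i; rewrite eqxx.
by move=> j; case: eqVneq => // ->.
Qed.

Lemma open_borel (A : set 'rV[R]_d) : open A -> measurable (A : set (borel_rV R d)).
Proof. by move=> oA; apply: sub_sigma_algebra. Qed.

Lemma measurable_opp : measurable_fun setT ((fun x => - x) : borel_rV R d -> borel_rV R d).
Proof.
apply: (@measurability _ _ (borel_rV R d) (borel_rV R d) setT _ open) => // _ [A oA <-];
  rewrite setTI.
apply: open_borel; apply: open_comp oA => x _; exact: opp_continuous.
Qed.

Lemma measurable_dot_gt (a : R) (u : 'cV[R]_d) :
  measurable ([set x | a < dot x u] : set (borel_rV R d)).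
Proof.
have cu : continuous (fun x : 'rV[R]_d => dot x u).
  rewrite (_ : (fun _ => _) = (fun x : 'rV[R]_d => \sum_j x 0 j * u j 0)); last first.
    by apply/funext => y; rewrite /dot mxE.
  apply: continuous_big => [|j _ x]; first exact: add_continuous.
  apply: continuousM; [exact: coord_continuous|exact: cst_continuous].
apply: open_borel; rewrite (_ : mkset _ = (fun x => dot x u) @^-1` [set y | a < y])//.
by apply: open_comp => [x _|]; [exact: cu|exact: open_gt].
Qed.

Lemma measurable_hyperplane (u : 'cV[R]_d) :
  measurable ([set x | x *m u = 0] : set (borel_rV R d)).
Proof.
have -> : [set x : 'rV[R]_d | x *m u = 0] =
    ~` ([set x | 0 < dot x u] `|` [set x | 0 < dot x (- u)]).
  apply/seteqP; split=> x /=.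
    by move=> xu [|]; rewrite /dot ?mulmxN xu mxE ?mxE ?oppr0 ltxx.
  move=> /not_orP[/negP + /negP]; rewrite dotNr oppr_gt0 -!leNgt => h1 h2.
  apply/matrixP => i j; rewrite !ord1 [RHS]mxE; apply/le_anti.
  by rewrite h1 h2.
by apply: measurableC; apply: measurableU; exact: measurable_dot_gt.
Qed.

Lemma measurable_flip J : measurable_fun setT (flip J : tuple_rV -> tuple_rV).
Proof.
apply: measurable_fun_tuple => i; rewrite /flip; case: (i \in J);
  last exact: measurable_coordinate.
apply: (measurableT_comp measurable_opp); exact: measurable_coordinate.
Qed.

End TupleSpace.

Lemma disjoint_setU1 (T : finType) (y : T) (Z Y : {set T}) : y \notin Z ->
  [disjoint Z & Y]%B -> [disjoint Z & y |: Y]%B.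
Proof.
move=> yZ ZY; rewrite finset.disjoints_subset; apply/fintype.subsetP => i iZ.
rewrite !inE (disjointFr ZY iZ) orbF.
by apply: contraNneq yZ => <-.
Qed.

(** * Measurability of the separation events and of proper hulls *)

Section MeasurableEvents.
Context (R : realType) (d N : nat).
Implicit Types (x : 'I_N -> 'rV[R]_d) (Z Y I J : {set 'I_N}) (u : 'cV[R]_d).

Lemma rational_approximation x u (eta : R) : 0 < eta ->
  exists q : 'cV[rat]_d, let v := map_mx ratr q in
    (forall i, `|dot (x i) v - dot (x i) u| < eta) /\
    (forall j, `|v j 0 - u j 0| < eta).
Proof.
(* [K] is a common Lipschitz constant of all [dot (x i)] in the maximum norm, so coordinates within
   [eta / K] are enough; [1 <= K] yields the second bound. *)
move=> eta0; pose K : R := 1 + \sum_i \sum_j `|x i 0 j|.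
have K1 : 1 <= K by rewrite lerDl sumr_ge0// => i _; rewrite sumr_ge0.
have K0 : 0 < K by apply: lt_le_trans K1.
have e0 : 0 < eta / K by rewrite divr_gt0.
have h j : exists q : rat, u j 0 < ratr q < u j 0 + eta / K.
  have [|q] := @rat_in_itvoo R (u j 0) (u j 0 + eta / K); first by rewrite ltrDl.
  by rewrite in_itv /=; exists q.
have /choice[q hq] := h; exists (\col_j q j) => v.
have vu j : `|v j 0 - u j 0| < eta / K.
  rewrite !mxE; have /andP[q1 q2] := hq j.
  by rewrite gtr0_norm ?subr_gt0// ltrBlDl.
split=> [i|j]; last first.
  by apply: lt_le_trans (vu j) _; rewrite ler_pdivrMr// ler_peMr// ltW.
rewrite /dot !mxE -sumrB.
apply: le_lt_trans (ler_norm_sum _ _ _) _.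
apply: (@le_lt_trans _ _ (\sum_j `|x i 0 j| * (eta / K))).
  by apply: ler_sum => j _; rewrite -mulrBr normrM ler_wpM2l// ltW.
rewrite -mulr_suml mulrA ltr_pdivrMr// mulrC ltr_pM2l//.
rewrite /K (bigD1 i)//= addrCA ltrDl ltr_pwDl// sumr_ge0// => k _.
by rewrite sumr_ge0.
Qed.

Lemma measurable_sep0 Y : measurable (sep finset.set0 Y : set (tuple_rV R d N)).
Proof.
have -> : sep finset.set0 Y = \bigcup_(q in [set: 'cV[rat]_d])
    \bigcap_(i in [set` Y]) (fun x : tuple_rV R d N => x i) @^-1` [set z | 0 < dot z
      (map_mx ratr q)].
  apply/seteqP; split=> x.
    move=> [u [_ uY]].
    (* With the direction [-1] the step [t] is a common lower bound of the values of [u] on [Y], the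
       margin for a rational replacement. *)
    have [t t0 ht] := @exists_small_step R _ (mem Y) (fun i => dot (x i) u) (fun=> -1) uY.
    have [q [hq _]] := rational_approximation x u t0.
    exists q => // i iY /=; have := hq i; have := ht i iY; rewrite ltr_norml => + /andP[].
    lra.
  by move=> [q _ hq]; exists (map_mx ratr q); split=> i; [rewrite inE|move=> iY; exact: hq].
apply: countable_bigcupT_measurable => [|q]; first exact: countableP.
apply: fin_bigcap_measurable => [|i _]; first exact: finite_finset.
rewrite -[X in measurable X]setTI; apply: measurable_coordinate => //.
exact: measurable_dot_gt.
Qed.

Lemma measurable_flip_preimage J (A : set (tuple_rV R d N)) :
  measurable A -> measurable (flip J @^-1` A : set (tuple_rV R d N)).
Proof. by move=> mA; rewrite -[X in measurable X]setTI; apply: measurable_flip. Qed.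

Lemma measurable_general_position :
  measurable (@general_position R d N : set (tuple_rV R d N)).
Proof.
have -> : @general_position R d N = \bigcap_(I in [set I : {set 'I_N} | (#|I| <= d)%N])
    \bigcap_(J in [set: {set 'I_N}]) flip J @^-1` (sep finset.set0 I).
  by apply/seteqP; split=> x h; [move=> I Id J _; exact: h|move=> I J Id; exact: h].
apply: fin_bigcap_measurable => [|I _]; first exact: finite_finset.
apply: fin_bigcap_measurable => [|J _]; first exact: finite_finset.
by apply: measurable_flip_preimage; exact: measurable_sep0.
Qed.

(** Equations on [Z] cannot be tested on rational functionals. In general position [sep_setI] trades
    them one by one for strict inequalities of both signs. *)
Lemma measurable_sep Z Y : [disjoint Z & Y]%B -> (#|Z| <= d)%N ->
  measurable (sep Z Y `&` @general_position R d N : set (tuple_rV R d N)).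
Proof.
move nE : #|Z| => n; elim: n Z Y nE => [|n IH] Z Y nE ZY nd.
  have -> : Z = finset.set0 by apply/eqP; rewrite -cards_eq0 nE.
  by apply: measurableI; [exact: measurable_sep0|exact: measurable_general_position].
have [y yZ] : exists y, y \in Z by apply/set0Pn; rewrite -card_gt0 nE.
have yY : y \notin Y by rewrite (disjointFr ZY).
have yZy : y \notin Z :\ y by rewrite !inE eqxx.
have Zy : #|Z :\ y| = n by move: nE; rewrite (cardsD1 y Z) yZ add1n => -[].
have h : [disjoint Z :\ y & Y]%B by apply: disjointWl ZY; exact: subD1set.
have h' : [disjoint Z :\ y & y |: Y]%B by exact: disjoint_setU1.
pose A := sep (Z :\ y) (y |: Y) `&` @general_position R d N.
have -> : sep Z Y `&` @general_position R d N = A `&` flip [set y]%SET @^-1` A.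
  have hE x : general_position x -> sep Z Y x <-> sep (Z :\ y) (y |: Y) x /\
      sep (Z :\ y) (y |: Y) (flip [set y]%SET x).
    by rewrite -{1}(finset.setD1K yZ); apply: sep_setI => //; rewrite Zy.
  apply/seteqP; split=> x.
    move=> [/hE h1 gx]; have [s1 s2] := h1 gx.
    by split; split=> //; apply: general_position_flip.
  by move=> [[s1 gx] [s2 _]]; split=> //; apply/hE.
have mA : measurable (A : set (tuple_rV R d N)) by apply: IH => //; exact: ltnW.
by apply: measurableI => //; exact: measurable_flip_preimage.
Qed.

(** The weak inequalities are relaxed by [n.+1%:R^-1] and [u] is replaced by rational vectors
    bounded away from 0. Conversely, if the hull were everything, each signed basis vector would be
    a combination of total weight at most [M], which excludes such a [q] once [n.+1] exceeds [M]. *)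
Lemma positive_hull_properP x : positive_hull x <> setT <->
  forall n : nat, exists q : 'cV[rat]_d, (exists j, 1 <= `|q j 0|) /\
    forall i, - n.+1%:R^-1 < dot (x i) (map_mx ratr q).
Proof.
split.
  move=> /positive_hull_proper[u u0 hu] n.
  have [j uj] : exists j, u j 0 != 0.
    by apply: contrapT => /forallNP h; move/eqP: u0; apply; apply/colP => j; rewrite mxE;
      apply/eqP/negPn/negP/h.
  (* The scaling gives coordinate [j] modulus 2, so it keeps modulus at least 1 after an error of at
     most 1. *)
  have [] := @rational_approximation x ((2 / `|u j 0|) *: u) n.+1%:R^-1;
    first by rewrite invr_gt0.
  move=> q [qx qj]; exists q; split.
    exists j; rewrite -(ler_rat R) rmorph1 ratr_norm.
    have := qj j; rewrite !mxE => {}qj.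
    have n1 : n.+1%:R^-1 <= 1 :> R by rewrite invf_le1// ler1n.
    have : `|2 / `|u j 0| * u j 0| = 2 :> R.
      by rewrite normrM normrM normfV normr_id -mulrA mulVf ?normr_eq0// mulr1 ger0_norm.
    have := ler_normB (ratr (q j 0)) (ratr (q j 0) - 2 / `|u j 0| * u j 0).
    rewrite subKr => h1 h2; rewrite h2 in h1; have := lt_le_trans qj n1.
    by move: h1; move: (`|_ - _|) (`|ratr _|) => a b; lra.
  move=> i; have := qx i; rewrite ltr_norml dotZr => /andP[+ _].
  have : 0 <= 2 / `|u j 0| * dot (x i) u by rewrite mulr_ge0// divr_ge0.
  by move=> B0 h; apply: lt_le_trans h _; rewrite lerBlDr lerDl.
move=> hn hx.
have h (p : 'I_d * bool) : exists c : 'I_N -> R, (forall i, 0 <= c i) /\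
    ((-1) ^+ p.2 *: delta_mx 0 p.1 = \sum_i c i *: x i).
  have : positive_hull x ((-1) ^+ p.2 *: delta_mx 0 p.1) by rewrite hx.
  by case=> c c0 hc; exists c.
have /choice[c hc] := h; pose M := \sum_p \sum_i c p i.
have cM p : \sum_i c p i <= M.
  rewrite /M (bigD1 p)//= lerDl sumr_ge0// => p' _; rewrite sumr_ge0// => i _.
  by have [+ _] := hc p'; apply.
have [n Mn] : exists n, M < n.+1%:R.
  exists (Num.truncn M); exact: truncnS_gt.
have [q [[j qj] hq]] := hn n.
(* The sign is chosen so that [q] takes the value [- |q j|] at the signed basis vector. *)
pose p := (j, 0 < q j 0); have [c0 cE] := hc p.
have : dot ((-1) ^+ p.2 *: delta_mx 0 p.1) (map_mx ratr q) = - `|ratr (q j 0)| :> R.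
  rewrite dotZl /dot -rowE !mxE /p/=; have [q0|q0] := ltP 0 (q j 0).
    by rewrite mulN1r gtr0_norm// ltr0q.
  by rewrite mul1r ler0_norm ?opprK// lerq0.
have {}qj : 1 <= `|ratr (q j 0)| :> R by rewrite -ratr_norm -(rmorph1 (ratr : rat -> R))
  ler_rat.
rewrite cE dot_suml => hs.
have : \sum_i c p i * - n.+1%:R^-1 <= - `|ratr (q j 0)| :> R.
  by rewrite -hs; apply: ler_sum => i _; rewrite dotZl ler_wpM2l// ltW.
rewrite -mulr_suml mulrN lerN2 => h1.
have : M / n.+1%:R < 1 by rewrite ltr_pdivrMr// mul1r.
have : (\sum_i c p i) / n.+1%:R <= M / n.+1%:R by rewrite ler_pM2r// invr_gt0.
by move=> h2 h3; have := le_lt_trans (le_trans qj (le_trans h1 h2)) h3; rewrite ltxx.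
Qed.

Lemma measurable_positive_hull_proper :
  measurable ([set x | positive_hull x <> setT] : set (tuple_rV R d N)).
Proof.
have -> : [set x | positive_hull x <> setT] = \bigcap_n
  \bigcup_(q in [set q : 'cV[rat]_d | exists j, 1 <= `|q j 0|])
    \bigcap_(i in [set: 'I_N]) (fun x : tuple_rV R d N => x i) @^-1`
      [set z | - n.+1%:R^-1 < dot z (map_mx ratr q)].
  apply/seteqP; split=> x /=.
    by move=> /positive_hull_properP h n _; have [q [qj hq]] := h n; exists q => // i _;
      apply: hq.
  move=> h; apply/positive_hull_properP => n; have [q qj hq] := h n I.
  by exists q; split=> // i; apply: hq.
apply: bigcap_measurableType => n _.
rewrite bigcup_mkcond; apply: countable_bigcupT_measurable => [|q]; first exact: countableP.
case: ifP => // _.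
apply: fin_bigcap_measurable => [|i _]; first exact: finite_finset.
rewrite -[X in measurable X]setTI; apply: measurable_coordinate => //.
exact: measurable_dot_gt.
Qed.

End MeasurableEvents.

Lemma null_fin_bigcup d (T : measurableType d) (R : realType) (mu : {measure set T -> \bar R})
    (K : finType) (F : K -> set T) :
  (forall k, measurable (F k) /\ mu (F k) = 0%E) -> mu (\bigcup_k F k) = 0%E.
Proof.
move=> hF; rewrite (_ : \bigcup_k F k = \big[setU/set0]_(k : K) F k); last first.
  by rewrite -bigcup_seq; congr (\bigcup_(k in _) _); apply/seteqP; split=> k //= _;
    rewrite mem_index_enum.
suff : measurable (\big[setU/set0]_(k : K) F k) /\ mu (\big[setU/set0]_(k : K) F k) = 0%E
  by case.
elim/big_ind: _ => // A B [mA A0] [mB B0].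
split; first exact: measurableU.
apply/eqP; rewrite eq_le measure_ge0 andbT -[leRHS](adde0 0%E) -{1}A0 -B0.
exact: measureU2.
Qed.

(* Number of sign vectors realized by [n] linear functionals in general position
   on an [m]-dimensional space (Schlafli). *)
Definition cells (n m : nat) : nat :=
  if n is n'.+1 then 2 * \sum_(i < m) 'C(n', i) else 1.

Lemma cells_rec n m : cells n.+1 m.+1 = (cells n m.+1 + cells n m)%N.
Proof.
case: n => [|n] /=.
  by rewrite big_ord_recl big1.
rewrite -mulnDr; congr (2 * _)%N; rewrite !big_ord_recl/= !bin0 -addnA; congr (_ + _)%N.
by rewrite -big_split/=; apply: eq_bigr => i _; rewrite binS.
Qed.

Lemma cells_gt0 n m : (0 < m)%N -> (0 < cells n m)%N.
Proof. by case: n m => [|n] [|m]//= _; rewrite big_ord_recl bin0 mulnDr ltn_addr. Qed.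

(** * Almost sure general position and the probability of separation *)

Section Law.
Context (R : realType) (d N : nat).
Variables (phi : probability (borel_rV R d) R) (mu : probability (tuple_rV R d N) R).
Hypothesis mu_rectangle : forall B : 'I_N -> set (borel_rV R d),
  (forall i, measurable (B i)) -> mu (rectangle B) = (\prod_(i < N) phi (B i))%E.
Hypothesis phi_even : forall A : set (borel_rV R d), measurable A ->
  phi [set - x | x in (A : set 'rV[R]_d)] = phi A.
Hypothesis phi_hyperplane : forall u : 'cV[R]_d, u != 0 ->
  phi [set x : 'rV[R]_d | x *m u = 0] = 0%E.

Local Notation gp := (@general_position R d N).

Lemma law_flip J (A : set (tuple_rV R d N)) : measurable A -> mu (flip J @^-1` A) = mu A.
Proof.
move=> mA; have mf := @measurable_flip R d N J.
pose f : {mfun tuple_rV R d N >-> tuple_rV R d N} := mfun_Sub (mem_set mf).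
rewrite -[LHS]/(distribution mu f A); apply/esym/tuple_measure_unique => // B mB.
rewrite /distribution/= /pushforward mu_rectangle//.
pose B' i := if i \in J then [set - x | x in (B i : set 'rV[R]_d)] : set (borel_rV R d)
  else B i.
have oppE (A' : set (borel_rV R d)) : [set - x | x in (A' : set 'rV[R]_d)] = -%R @^-1` A'.
  apply/seteqP; split=> x /=; first by move=> [y Ay <-]; rewrite opprK.
  by exists (- x); rewrite ?opprK.
transitivity (mu (rectangle B')); last first.
  congr (mu _); apply/seteqP; split=> x /= h i; move: (h i); rewrite /= /flip /B'.
    by case: ifP => // iJ; rewrite oppE.
  by case: ifP => // iJ; rewrite oppE.
rewrite mu_rectangle; last first.
  move=> i; rewrite /B'; case: ifP => // _; rewrite oppE -[X in measurable X]setTI.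
  exact: measurable_opp.
by apply: eq_bigr => i _; rewrite /B'; case: ifP => // _; rewrite phi_even.
Qed.

Definition upd (i : 'I_N) (p : tuple_rV R d N * borel_rV R d) : tuple_rV R d N :=
  fun j => if j == i then p.2 else p.1 j.

(* Resampling one coordinate does not change the law, so Fubini's theorem
   applies to it. *)
Lemma law_null_sections i (A : set (tuple_rV R d N)) : measurable A ->
  (forall x, phi [set z | A (upd i (x, z))] = 0%E) -> mu A = 0%E.
Proof.
move=> mA A0; have mf : measurable_fun setT (upd i).
  apply: measurable_fun_tuple => j; rewrite /upd; case: (j == i).
    exact: measurable_snd.
  apply: measurableT_comp (measurable_coordinate j) _; exact: measurable_fst.
pose f : {mfun (tuple_rV R d N * borel_rV R d)%type >-> tuple_rV R d N} := mfun_Sub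
  (mem_set mf).
have -> : mu A = pushforward (mu \x phi)%E f A.
  apply: tuple_measure_unique => // B mB.
  rewrite /pushforward mu_rectangle// (bigD1 i)//= muleC.
  pose B' j := if j == i then setT else B j.
  have mB' j : measurable (B' j) by rewrite /B'; case: ifP.
  have B'i : B' i = setT by rewrite /B' eqxx.
  transitivity ((mu \x phi)%E (rectangle B' `*` B i)); last first.
    congr ((mu \x phi)%E _); apply/seteqP; split=> -[x z] /=.
      move=> [h hi] j; have := h j; rewrite /= /upd /B'; case: ifP => //= /eqP ->//.
    move=> h; split; last by have := h i; rewrite /= /upd eqxx.
    by move=> j; have := h j; rewrite /= /upd /B'; case: ifP.
  rewrite product_measure1E//; last exact: measurable_rectangle.
  congr (_ * _)%E; rewrite -[RHS]/(mu (rectangle B')) mu_rectangle// [RHS](bigD1 i)//=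
    B'i probability_setT mul1e.
  by apply: eq_bigr => j /negPf ji; rewrite /B' ji.
rewrite /pushforward /product_measure1; apply: integral0_eq => x _ /=.
rewrite -[RHS](A0 x); congr (phi _).
by apply/seteqP; split=> z; rewrite /xsection/= inE.
Qed.

Definition realizable (I : {set 'I_N}) : set (tuple_rV R d N) :=
  [set x | forall J, sep finset.set0 I (flip J x)].

Lemma measurable_realizable I : measurable (realizable I).
Proof.
have -> : realizable I = \bigcap_(J in [set: {set 'I_N}]) flip J @^-1` (sep finset.set0 I).
  by apply/seteqP; split=> x h; [move=> J _; exact: h|move=> J; exact: h].
apply: fin_bigcap_measurable => [|J _]; first exact: finite_finset.
by apply: measurable_flip_preimage; exact: measurable_sep0.
Qed.

(** Induction on [#|I|]. Some nonzero [v] is orthogonal to the fewer than [d] vectors in [I :\ y];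
    if these realize all signs, adding vector [y] can only fail when it lies in the hyperplane of
    [v]. This has probability zero, and [law_null_sections] integrates over the rest. *)
Lemma law_realizable (I : {set 'I_N}) : (#|I| <= d)%N -> mu (~` realizable I) = 0%E.
Proof.
move nE : #|I| => n; elim: n I nE => [|n IH] I nE nd.
  have -> : I = finset.set0 by apply/eqP; rewrite -cards_eq0 nE.
  rewrite (_ : ~` _ = set0) ?measure0//; apply/seteqP; split=> x //=.
  by apply=> J; exists 0; split=> i; rewrite inE.
have [y yI] : exists y, y \in I by apply/set0Pn; rewrite -card_gt0 nE.
have Iy : #|I :\ y| = n by move: nE; rewrite (cardsD1 y I) yI add1n => -[].
have mI := measurable_realizable I; have mIy := measurable_realizable (I :\ y).
apply/eqP; rewrite eq_le measure_ge0 andbT.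
have le1 : (mu (~` realizable I) <= mu (~` realizable (I :\ y)) +
    mu (realizable (I :\ y) `\` realizable I))%E.
  apply: (@le_trans _ _ (mu (~` realizable (I :\ y) `|` (realizable (I :\ y) `\`
    realizable I)))); last first.
    by apply: measureU2; [exact: measurableC|exact: measurableD].
  apply: le_measure; rewrite ?inE; first exact: measurableC.
    by apply: measurableU; [exact: measurableC|exact: measurableD].
  by move=> x /= nx; have [h|] := pselect (realizable (I :\ y) x); [right|left].
apply: le_trans le1 _; rewrite IH ?Iy//; last exact: ltnW.
rewrite add0e (@law_null_sections y)//; first exact: measurableD.
move=> x.
have [/= hx|hx] := pselect (realizable (I :\ y) x); last first.
  rewrite (_ : mkset _ = set0) ?measure0//; apply/seteqP; split=> z //= -[h _].
  apply: hx => J; have [u [_ uI]] := h J; exists u; split=> i; first by rewrite inE.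
  move=> iI; have := uI i iI; rewrite /flip /upd/=.
  by move: iI; rewrite !inE => /andP[/negPf -> _].
have [|v v0 hv] := @exists_orthogonal R d _ (I :\ y) x; first by rewrite Iy.
apply/eqP; rewrite eq_le measure_ge0 andbT -[leRHS](phi_hyperplane v0).
have mA : measurable (realizable (I :\ y) `\` realizable I) by exact: measurableD.
have mu_upd : measurable_fun setT (fun z : borel_rV R d => upd y (x, z)).
  apply: measurable_fun_tuple => j; rewrite /upd/=.
  by case: (j == y); [exact: measurable_id|exact: measurable_cst].
apply: le_measure; rewrite ?inE; first by have := mu_upd measurableT _ mA; rewrite setTI.
  exact: measurable_hyperplane.
move=> z /= [_ hz]; apply: contrapT => zv; apply: hz => J.
have zv0 : dot z v != 0.
  by apply: contra_notN zv => /eqP zv; apply/matrixP => i j; rewrite !ord1 [RHS]mxE.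
have [u [_ uI]] := hx J.
have updE i w : i \in I :\ y -> dot (flip J (upd y (x, z)) i) w = dot (flip J x i) w.
  by rewrite !inE => /andP[/negPf iy _]; rewrite !dot_flip /upd/= iy.
pose a := dot (flip J (upd y (x, z)) y) u; pose b := dot (flip J (upd y (x, z)) y) v.
have b0 : b != 0.
  by rewrite /b dot_flip /upd/= eqxx mulf_neq0// signr_eq0.
(* With this [t] the value at the flipped vector [y] is 1, while the values on [I :\ y] are
   unchanged. *)
pose t := (1 - a) / b; exists (u + t *: v); split=> i; first by rewrite inE.
rewrite dotDr dotZr => iI; have [->|iy] := eqVneq i y.
  by rewrite -/a -/b /t -mulrA mulVf// mulr1 addrC subrK.
have iIy : i \in I :\ y by rewrite !inE iy.
by rewrite !updE// [X in t * X]dot_flip hv// !mulr0 addr0 uI.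
Qed.

Lemma law_general_position : mu gp = 1%E.
Proof.
have mC : mu (~` gp) = 0%E.
  have -> : ~` gp = \bigcup_(I in [set I : {set 'I_N} | (#|I| <= d)%N]) ~` realizable I.
    rewrite -setC_bigcap; congr (~` _).
    by apply/seteqP; split=> x h I; [move=> Id J; exact: h|move=> J Id; exact: h].
  rewrite bigcup_mkcond; apply: null_fin_bigcup => I.
  case: ifPn => [|_]; rewrite ?measure0//.
  rewrite inE => /= Id; split; last exact: law_realizable.
  by apply: measurableC; exact: measurable_realizable.
have := probability_setC mu (measurableC (@measurable_general_position R d N)).
by rewrite setCK mC sube0.
Qed.

Lemma law_sep (Z Y : {set 'I_N}) : [disjoint Z & Y]%B -> (#|Z| <= d)%N ->
  mu (sep Z Y `&` gp) = ((cells #|Y| (d - #|Z|))%:R / 2 ^+ #|Y|)%:E.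
Proof.
move nE : #|Y| => n; elim: n Z Y nE => [|n IH] Z Y nE ZY Zd.
  have -> : Y = finset.set0 by apply/eqP; rewrite -cards_eq0 nE.
  rewrite (_ : sep _ _ = setT) ?setTI ?law_general_position ?expr0 ?divr1//.
  apply/seteqP; split=> // x _; exists 0; split=> i; rewrite ?inE// => _.
  by rewrite /dot mulmx0 mxE.
have [y yY] : exists y, y \in Y by apply/set0Pn; rewrite -card_gt0 nE.
have yZ : y \notin Z by rewrite (disjointFl ZY).
have [Zd'|Zd'] := eqVneq #|Z| d.
  (* A functional vanishing on [d] vectors in general position is 0 and cannot be positive at [y],
     in accordance with [cells n.+1 0 = 0]. *)
  rewrite Zd' subnn /= big_ord0 muln0 mul0r (_ : _ `&` _ = set0) ?measure0//.
  apply/seteqP; split=> x //= -[[u [uZ uY]] gx].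
  have := uY y yY; rewrite (general_position_orthogonal gx Zd' uZ).
  by rewrite /dot mulmx0 mxE ltxx.
have {Zd Zd'} Zd : (#|Z| < d)%N by rewrite ltn_neqAle Zd'.
have yYy : y \notin Y :\ y by rewrite !inE eqxx.
have Yy : #|Y :\ y| = n by move: nE; rewrite (cardsD1 y Y) yY add1n => -[].
have ZYy : [disjoint Z & Y :\ y]%B by apply: disjointWr ZY; exact: subD1set.
have yZYy : [disjoint y |: Z & Y :\ y]%B by rewrite disjoint_sym disjoint_setU1 // disjoint_sym.
have cyZ : #|y |: Z| = #|Z|.+1 by rewrite cardsU1 yZ.
pose A := sep Z Y `&` gp; pose B := flip [set y]%SET @^-1` A.
have mA : measurable (A : set (tuple_rV R d N)) by apply: measurable_sep => //; exact: ltnW.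
have mB : measurable (B : set (tuple_rV R d N)) by exact: measurable_flip_preimage.
have ABU : A `|` B = sep Z (Y :\ y) `&` gp.
  apply/seteqP; split=> x.
    case=> -[sx gx].
      split=> //; apply/(@sep_setU R d N Z (Y :\ y) y) => //.
      by left; rewrite finset.setD1K.
    have {}gx : gp x by rewrite -(flipK [set y]%SET x); exact: general_position_flip.
    split=> //; apply/(@sep_setU R d N Z (Y :\ y) y) => //.
    by right; rewrite finset.setD1K.
  move=> [+ gx] => /(@sep_setU R d N Z (Y :\ y) y yZ yYy Zd x gx).
  rewrite finset.setD1K// => -[sx|sx]; [by left|right; split=> //].
  exact: general_position_flip.
have ABI : A `&` B = sep (y |: Z) (Y :\ y) `&` gp.
  apply/seteqP; split=> x.
    move=> [[s1 gx] [s2 _]]; split=> //; apply/(@sep_setI R d N Z (Y :\ y) y) => //.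
    by rewrite finset.setD1K.
  move=> [+ gx] => /(@sep_setI R d N Z (Y :\ y) y yZ yYy Zd x gx).
  rewrite finset.setD1K// => -[s1 s2]; split=> //; split=> //.
  exact: general_position_flip.
have Afin : (mu A < +oo)%E by rewrite (le_lt_trans (probability_le1 _ _))// ltry.
(* Inclusion and exclusion; since [B] has the measure of [A], this determines [mu A] from two events
   with the smaller set [Y :\ y]. *)
have : mu (A `|` B) = (mu A + mu B - mu (A `&` B))%E by exact: measureUfinl.
rewrite (_ : mu B = mu A); last exact: law_flip.
rewrite ABU ABI (IH Z) ?(IH (y |: Z)) ?cyZ//; last exact: ltnW.
have mAfin : mu A \is a fin_num by exact: fin_num_measure.
rewrite -/A -(fineK mAfin) -!EFinD => -[] h; congr (_%:E).
have -> : (d - #|Z| = (d - #|Z|.+1).+1)%N by rewrite subnSK.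
rewrite cells_rec natrD exprS; move: h; rewrite subnSK// => h.
have h2 : (2 : R) ^+ n != 0 by rewrite expf_neq0// pnatr_eq0.
set a := fine _ in h *.
have -> : a = ((cells n (d - #|Z|))%:R / 2 ^+ n + (cells n (d - #|Z|.+1))%:R / 2 ^+ n) /
  2 by lra.
by field.
Qed.

End Law.

Section LowerIntegral.
Local Open Scope ereal_scope.
Import HBNNSimple.

(* [f] is not assumed to be measurable: its integral is the lower integral. *)
Lemma ge0_integral_eq_off_null d (T : measurableType d) (R : realType)
    (mu : {measure set T -> \bar R}) (f g : T -> \bar R) (N : set T) :
  (forall x, 0 <= f x) -> (forall x, 0 <= g x) -> measurable_fun setT g ->
  measurable N -> mu N = 0 -> (forall x, ~ N x -> f x = g x) ->
  \int[mu]_x f x = \int[mu]_x g x.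
Proof.
move=> f0 g0 mg mN N0 fg; have mTN : measurable (setT `\` N) by exact: measurableD.
(* Simple functions below [f] are below [g] off [N]; conversely, those below [g] set to 0 on [N] are
   below [f]. *)
apply/eqP; rewrite eq_le; apply/andP; split.
  rewrite ge0_integralTE//; apply: ge_ereal_sup => _ [h hf <-].
  have h0 x : setT x -> 0 <= (h x)%:E by rewrite lee_fin.
  have mh : measurable_fun setT (fun x => (h x)%:E).
    by apply/measurable_EFinP; exact: measurable_funP.
  rewrite -integralT_nnsfun (ge0_negligible_integral mN measurableT mh h0 N0).
  rewrite [leRHS](ge0_negligible_integral mN measurableT mg _ N0)//.
  apply: ge0_le_integral => //.
  - by move=> x _; exact: h0.
  - by apply: measurable_funTS.
  - by apply: measurable_funTS.
  - by move=> x [_ Nx]; rewrite -fg.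
rewrite (ge0_negligible_integral mN measurableT mg _ N0)// integral_mkcond.
rewrite !ge0_integralTE//; last by move=> x; rewrite patchE; case: ifP.
apply: le_ereal_sup => _ [h hf <-]; exists h => // x; apply: le_trans (hf x) _.
by rewrite patchE; case: ifPn => // /set_mem[_ Nx]; rewrite fg.
Qed.

End LowerIntegral.

(** * The Cover-Efron formula *)

Section ExpectedFaceNumber.
Context (R : realType) (disp : measure_display) (T : measurableType disp).
Variables (P : probability T R) (d N : nat).
Variables (phi : probability (borel_rV R d) R) (X : 'I_N -> {RV P >-> borel_rV R d}).
Hypothesis phi_even : forall A : set (borel_rV R d), measurable A ->
  phi [set - x | x in (A : set 'rV[R]_d)] = phi A.
Hypothesis phi_hyperplane : forall u : 'cV[R]_d, u != 0 ->
  phi [set x : 'rV[R]_d | x *m u = 0] = 0%E.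
Hypothesis X_distribution : forall (i : 'I_N) (A : set (borel_rV R d)), measurable A ->
  distribution P (X i) A = phi A.
Hypothesis X_independent : mutually_independent X.

Let Xt (w : T) : tuple_rV R d N := fun i => X i w.

Let measurable_Xt : measurable_fun setT Xt.
Proof. by apply: measurable_fun_tuple => i; exact: measurable_funP. Qed.

Let Xm : {mfun T >-> tuple_rV R d N} := mfun_Sub (mem_set measurable_Xt).

Let mu : probability (tuple_rV R d N) R := distribution P Xm.

Local Notation gp := (@general_position R d N).

Let mu_rectangle (B : 'I_N -> set (borel_rV R d)) :
  (forall i, measurable (B i)) -> mu (rectangle B) = (\prod_(i < N) phi (B i))%E.
Proof.
move=> mB; have := X_independent (J := [set: 'I_N]%SET) (fun i _ => mB i).
rewrite (_ : \bigcap_(i in _) _ = Xm @^-1` rectangle B); last first.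
  apply/seteqP; split=> w h i; first by apply: (h i); rewrite /= inE.
  by move=> _; exact: (h i).
rewrite -[P _]/(mu (rectangle B)) => ->.
by apply: eq_big => [i|i _]; [rewrite inE|exact: (X_distribution i (mB i))].
Qed.

Let mu_gpI A : measurable A -> mu A = mu (A `&` gp).
Proof.
move=> mA; have mgp := @measurable_general_position R d N.
have gC : mu (~` gp) = 0%E.
  by rewrite probability_setC// (law_general_position mu_rectangle phi_hyperplane) subee.
rewrite -[in LHS](setIT A) -(setvU gp) setIUr measureU; last 3 first.
- by apply: measurableI => //; exact: measurableC.
- exact: measurableI.
- by apply/seteqP; split=> x //= -[[_ ?] []].
rewrite [X in (X + _)%E](_ : _ = 0%E) ?add0e//.
apply/eqP; rewrite eq_le measure_ge0 andbT -[leRHS]gC; apply: le_measure; rewrite ?inE//.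
- by apply: measurableI => //; exact: measurableC.
- exact: measurableC.
Qed.

Lemma expected_face_numberE k : (d < N)%N -> (0 < k < d)%N ->
  expected_face_number X k =
  ('C(N, k)%:R * ((cells (N - k) (d - k))%:R / 2 ^+ (N - k)) /
   ((cells N d)%:R / 2 ^+ N))%:E.
Proof.
move=> dN kd; have /andP[k0 kd'] := kd.
have N0 : (0 < N)%N by apply: leq_ltn_trans dN.
pose E := [set w | positive_hull (fun i => X i w : 'rV[R]_d) <> setT].
have mE : measurable E by exact: (measurable_funPTI Xm (@measurable_positive_hull_proper
  R d N)).
have mgp := @measurable_general_position R d N.
have NE : (fun x : tuple_rV R d N => positive_hull x <> setT) `&` gp =
    sep finset.set0 (~: finset.set0) `&` gp.
  apply/seteqP; split=> x [h gx]; split=> //.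
    exact/positive_hull_proper_general.
  by apply/positive_hull_proper_general.
have PE : P E = ((cells N d)%:R / 2 ^+ N)%:E.
  have -> : P E = mu [set x | positive_hull x <> setT] by [].
  rewrite mu_gpI; last exact: measurable_positive_hull_proper.
  rewrite NE (law_sep mu_rectangle phi_even phi_hyperplane) ?cards0//.
    by rewrite finset.setC0 cardsT card_ord subn0.
  by rewrite finset.disjoints_subset finset.sub0set.
have IC (I : {set 'I_N}) : [disjoint I & ~: I]%B by rewrite finset.disjoints_subset
  finset.setCK.
pose c : R := (cells (N - k) (d - k))%:R / 2 ^+ (N - k).
(* The empty set as value outside [S] makes [F I] measurable for every [I]. *)
pose S : {set {set 'I_N}} := [set I : {set 'I_N} | #|I| == k]%SET.
pose F (I : {set 'I_N}) : set T := if I \in S then Xt @^-1` (sep I (~: I) `&` gp) else set0.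
have mF I : measurable (F I).
  rewrite /F inE; case: ifP => // /eqP Ik; apply: (measurable_funPTI Xm).
  by apply: measurable_sep => //; rewrite Ik ltnW.
have PF I : I \in S -> P (F I) = c%:E.
  move=> IS; rewrite /F IS; move: IS; rewrite inE => /eqP Ik.
  rewrite -[P _]/(mu (sep I (~: I) `&` gp)).
  rewrite (law_sep mu_rectangle phi_even phi_hyperplane) ?Ik//; last exact: ltnW.
  by rewrite (cardsCs (~: I)) finset.setCK card_ord Ik.
pose g w : \bar R := (\sum_(I <- enum S) (\1_(F I) w)%:E)%E.
have mg : measurable_fun setT g.
  by apply: emeasurable_sum => I; apply/measurable_EFinP; exact: measurable_indic.
have intg : (\int[P]_w g w = ('C(N, k)%:R * c)%:E)%E.
  rewrite /g ge0_integral_sum//; last first.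
    by move=> I; apply/measurable_EFinP; exact: measurable_indic.
  rewrite (eq_big_seq (fun=> c%:E)) => [|I]; last first.
    by rewrite mem_enum => IS; rewrite integral_indic// setIT; exact: PF.
  rewrite sumEFin big_const_seq count_predT -cardE card_draws card_ord iter_addr_0.
  by rewrite mulr_natl.
have fg w : gp (Xt w) -> ((fun w => face_number (positive_hull (fun i => X i w :
  'rV[R]_d)) k) \_ E) w = g w.
  move=> gw; rewrite /patch; case: ifPn => [wE|/negP wE].
    rewrite face_number_general// /g sumEFin; congr (_%:E).
    rewrite -sum1_card natr_sum big_enum/= [RHS]big_mkcond [LHS]big_mkcond.
    apply: eq_bigr => I _; rewrite indicE /F !inE.
    case: (#|I| == k) => //=; case: asboolP => h; first by rewrite mem_set.
    by rewrite memNset// => -[].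
  (* Off [E] every indicator is 0: a functional vanishing on [I] and positive on the nonempty
     complement would make the hull proper. *)
  rewrite /g big1_seq// => I /andP[_]; rewrite mem_enum => IS.
  rewrite indicE memNset// /F IS => -[[u [uI uI']] _]; apply: wE; apply/mem_set.
  move: IS; rewrite inE => /eqP Ik.
  have [j jI] : exists j, j \in ~: I.
    apply/set0Pn; rewrite -card_gt0 -(ltn_add2l #|I|) cardsC card_ord addn0 Ik.
    exact: ltn_trans dN.
  apply/positive_hull_proper; exists u.
    by apply: contraTneq (uI' j jI) => ->; rewrite /dot mulmx0 mxE ltxx.
  move=> i; have [iI|iI] := boolP (i \in I); first by rewrite uI.
  by rewrite ltW// uI'// inE.
rewrite /expected_face_number /cond_expectation -/E PE.
rewrite integral_mkcond (@ge0_integral_eq_off_null _ _ _ _ _ g (~` (Xt @^-1` gp))) //.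
- have c0 : (cells N d)%:R / 2 ^+ N != 0 :> R.
    by rewrite mulf_neq0 ?invr_eq0 ?expf_neq0 ?pnatr_eq0// -lt0n cells_gt0// (ltn_trans k0).
  by rewrite intg inver (negPf c0) -EFinM.
- move=> w; rewrite patchE; case: ifP => // _; rewrite /face_number /counting.
  by case: asboolP => _; rewrite ?lee_fin ?leey.
- by move=> w; rewrite /g sume_ge0// => I _; rewrite lee_fin.
- by apply: measurableC; apply: (measurable_funPTI Xm).
- rewrite -[LHS]/(mu (~` gp)) probability_setC//.
  by rewrite (law_general_position mu_rectangle phi_hyperplane) subee.
- by move=> w /= /contrapT; exact: fg.
Qed.

End ExpectedFaceNumber.

(** * Stirling's formula *)

Section Stirling.
Context {R : realType}.

Lemma ge0_of_is_derive (F F' : R -> R) (a : R) :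
  (forall t, a <= t -> is_derive t 1 F (F' t)) -> (forall t, a <= t -> 0 <= F' t) ->
  F a = 0 -> forall y, a <= y -> 0 <= F y.
Proof.
move=> dF F'0 Fa y; rewrite le_eqVlt => /predU1P[<-|ay]; first by rewrite Fa.
have [z||c] := @MVT R F F' a y ay.
- by rewrite in_itv/= => /andP[/ltW az _]; exact: dF.
- apply: derivable_within_continuous => z; rewrite in_itv/= => /andP[az _].
  by have := dF z az => dz; exact: ex_derive.
rewrite in_itv/= Fa subr0 => /andP[/ltW ac _] ->.
by rewrite mulr_ge0 ?F'0// subr_ge0 ltW.
Qed.

Lemma is_derive_invDr (a t : R) : t + a != 0 ->
  is_derive t 1 (fun t : R => (t + a)^-1) (- (t + a) ^- 2).
Proof.
move=> ta; have d : is_derive t 1 (fun t : R => t + a) 1.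
  by apply: is_derive_eq; rewrite addr0.
have := @is_deriveV R (fun t => t + a) t 1 1 ta d.
by rewrite /GRing.scale/= mulr1.
Qed.

(** The midpoint rule for the integral of [1 / x] over [[1, t]], which underestimates it by
    convexity. At [t = 1 + 1 / a] it shows that the Stirling remainder decreases. *)
Lemma ln_ge_frac (t : R) : 1 <= t -> 2 - 4 / (t + 1) <= ln t.
Proof.
move=> t1; rewrite -subr_ge0.
apply: (@ge0_of_is_derive (fun t => ln t - (2 - 4 * (t + 1)^-1))
  (fun t => t^-1 - (0 - 4 * (- (t + 1) ^- 2))) 1) => // {t t1} [t t1|t t1|].
- have t0 : 0 < t by lra.
  have d1 := is_derive1_ln t0.
  have t0' : t + 1 != 0 by lra.
  have d2 := is_derive_invDr t0'.
  by apply: is_derive_eq; rewrite /GRing.scale/=; ring.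
- have t0 : 0 < t by lra.
  have -> : t^-1 - (0 - 4 * (- (t + 1) ^- 2)) = (t - 1) ^+ 2 * (t^-1 * (t + 1)^-2).
    by field; rewrite !gt_eqF//; lra.
  by rewrite mulr_ge0 ?sqr_ge0// mulr_ge0 ?invr_ge0 ?exprn_ge0//; lra.
- by rewrite ln1; field.
Qed.

(** The trapezoidal rule for the same integral, an overestimate; it bounds the decrease of the
    Stirling remainder. *)
Lemma ln_le_trapezoid (t : R) : 1 <= t -> ln t <= (t - t^-1) / 2.
Proof.
move=> t1; rewrite -subr_ge0 -[X in X^-1]addr0.
apply: (@ge0_of_is_derive (fun t => (t - (t + 0)^-1) * 2^-1 - ln t)
  (fun t => (1 - (- (t + 0) ^- 2)) * 2^-1 - t^-1) 1) => // {t t1} [t t1|t t1|].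
- have t0 : 0 < t by lra.
  have d1 := is_derive1_ln t0.
  have t0' : t + 0 != 0 by lra.
  have d2 := is_derive_invDr t0'.
  by apply: is_derive_eq; rewrite /GRing.scale/=; ring.
- have t0 : 0 < t by lra.
  have -> : (1 - (- (t + 0) ^- 2)) * 2^-1 - t^-1 = (t - 1) ^+ 2 * (t ^- 2 * 2^-1).
    by field; rewrite gt_eqF//; lra.
  by rewrite mulr_ge0 ?sqr_ge0// mulr_ge0 ?invr_ge0 ?exprn_ge0//; lra.
- by rewrite ln1; field.
Qed.

End Stirling.

Section Multinomial.
Context {R : realType}.

Lemma stirling n : (0 < n)%N ->
  0 <= ln (n`!%:R : R) - ((n%:R + 2^-1) * ln n%:R - n%:R) <= 1.
Proof.
move=> n0; pose r n : R := ln (n`!%:R : R) - ((n%:R + 2^-1) * ln n%:R - n%:R).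
(* The remainder starts at [r 1 = 1] and decreases by at most [(4 * n)^-1 - (4 * (n + 1))^-1] per
   step, which telescopes; hence the extra term in the lower bound. *)
suff : 3 / 4 + (4 * n%:R)^-1 <= r n <= 1.
  move=> /andP[h1 h2]; rewrite -/(r n) h2 andbT.
  have h3 : 0 <= (4 * n%:R)^-1 :> R by rewrite invr_ge0 mulr_ge0.
  lra.
elim: n n0 => // -[_ _|n IH _].
  rewrite /r (_ : 1`! = 1%N)// ln1 mulr0 mulr1; apply/andP; split; lra.
have /andP[h1 h2] := IH isT.
set a : R := n.+1%:R; have a0 : 0 < a by rewrite ltr0n.
have aS : n.+2%:R = a + 1 by rewrite /a -natr1.
have a1 : 0 < a + 1 by lra.
have rS : r n.+2 = r n.+1 - ((a + 2^-1) * ln ((a + 1) / a) - 1).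
  rewrite /r factS natrM lnM ?posrE ?ltr0n ?fact_gt0//.
  rewrite ln_div ?posrE// aS -/a; ring.
have t1 : 1 <= (a + 1) / a by rewrite ler_pdivlMr//; lra.
have l1 := ln_ge_frac t1; have l2 := ln_le_trapezoid t1.
have e1 : 2 - 4 / ((a + 1) / a + 1) = (a + 2^-1)^-1.
  by field; rewrite !gt_eqF//; lra.
have e2 : ((a + 1) / a - ((a + 1) / a)^-1) / 2 = (1 + ((4 * a)^-1 - (4 * (a + 1))^-1)) /
  (a + 2^-1).
  by field; rewrite !gt_eqF//; lra.
rewrite e1 in l1; rewrite e2 in l2.
have ah : 0 < a + 2^-1 by lra.
have m1 : 1 <= (a + 2^-1) * ln ((a + 1) / a).
  by rewrite -ler_pdivrMl// mulr1.
have m2 : (a + 2^-1) * ln ((a + 1) / a) <= 1 + ((4 * a)^-1 - (4 * (a + 1))^-1).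
  by rewrite mulrC -ler_pdivlMr.
rewrite rS aS; move: h1 h2 m1 m2; rewrite -/a.
move: (_ * ln _) (4 * a)^-1 (4 * (a + 1))^-1 (r n.+1) => u v w z *.
by apply/andP; split; lra.
Qed.

(** The terms [d ln d] of the two entropies cancel. What remains is the leading part of the
    logarithm of the multinomial coefficient of [k], [d - k] and [N - d], minus [(N - k) ln 2]. *)
Lemma threshold_exponentE (N d k : nat) : (0 < k < d)%N -> (d < N)%N ->
  N%:R * threshold_exponent (d%:R / N%:R) (k%:R / d%:R) =
  N%:R * ln N%:R - (N - d)%:R * ln (N - d)%:R - k%:R * ln k%:R
  - (d - k)%:R * ln (d - k)%:R - (N - k)%:R * ln 2 :> R.
Proof.
move=> /andP[k0 kd] dN.
have d0 := ltn_trans k0 kd; have N0 := ltn_trans d0 dN; have kN := ltn_trans kd dN.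
rewrite /threshold_exponent /binary_entropy.
have e1 : 1 - d%:R / N%:R = (N - d)%:R / N%:R :> R.
  by rewrite natrB 1?ltnW//; field; rewrite pnatr_eq0 -lt0n.
have e2 : 1 - k%:R / d%:R = (d - k)%:R / d%:R :> R.
  by rewrite natrB 1?ltnW//; field; rewrite pnatr_eq0 -lt0n.
rewrite e1 e2 !ln_div ?posrE ?ltr0n ?subn_gt0//.
move: (ln N%:R) (ln d%:R) (ln k%:R) (ln (N - d)%:R) (ln (d - k)%:R) (ln 2) => l1 l2 l3 l4 l5 l6.
rewrite (natrB _ (ltnW dN)) (natrB _ (ltnW kd)) (natrB _ (ltnW kN)).
have : N%:R != 0 :> R by rewrite pnatr_eq0 -lt0n.
have : d%:R != 0 :> R by rewrite pnatr_eq0 -lt0n.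
move: N%:R d%:R k%:R => a b c a0 b0; field.
by rewrite a0 b0.
Qed.

(** The linear terms of Stirling's formula cancel; one remainder in [[0, 1]] enters with a plus sign
    and three with a minus sign. *)
Lemma ln_multinomial (N d k : nat) : (0 < k < d)%N -> (d < N)%N ->
  -3 <= ln (('C(N, k) * 'C(N - k, d - k))%:R : R) -
    ((N%:R + 2^-1) * ln N%:R - ((N - d)%:R + 2^-1) * ln (N - d)%:R
     - (k%:R + 2^-1) * ln k%:R - ((d - k)%:R + 2^-1) * ln (d - k)%:R) <= 1.
Proof.
move=> /andP[k0 kd] dN.
have d0 := ltn_trans k0 kd; have N0 := ltn_trans d0 dN; have kN := ltn_trans kd dN.
have kd' : (d - k <= N - k)%N by rewrite leq_sub2r// ltnW.
have fE : ('C(N, k) * 'C(N - k, d - k) * (k`! * (d - k)`! * (N - d)`!) = N`!)%N.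
  rewrite -(bin_fact (ltnW kN)) -(bin_fact kd') subnBA ?subnK ?(ltnW kN) ?(ltnW kd)//.
  by ring.
have /andP[sN1 sN2] := stirling N0.
have /andP[sk1 sk2] := stirling k0.
have /andP[sm1 sm2] : 0 <= ln ((d - k)`!%:R : R) - (((d - k)%:R + 2^-1) * ln (d - k)%:R -
  (d - k)%:R) <= 1.
  by apply: stirling; rewrite subn_gt0.
have /andP[sx1 sx2] : 0 <= ln ((N - d)`!%:R : R) - (((N - d)%:R + 2^-1) * ln (N - d)%:R -
  (N - d)%:R) <= 1.
  by apply: stirling; rewrite subn_gt0.
have : ln (N`!%:R : R) = ln (('C(N, k) * 'C(N - k, d - k))%:R : R) +
   (ln (k`!%:R) + ln ((d - k)`!%:R) + ln ((N - d)`!%:R)).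
  rewrite -fE natrM lnM ?posrE ?ltr0n ?muln_gt0 ?fact_gt0 ?bin_gt0 ?(ltnW kN) ?kd'//.
  by congr (_ + _); rewrite 2!natrM !lnM ?posrE ?mulr_gt0 ?ltr0n ?fact_gt0.
have : N%:R = (N - d)%:R + k%:R + (d - k)%:R :> R.
  by rewrite -!natrD; congr (_%:R); lia.
move: sN1 sN2 sk1 sk2 sm1 sm2 sx1 sx2.
move: (ln (N`!%:R)) (ln k`!%:R) (ln (d - k)`!%:R) (ln (N - d)`!%:R) (ln (_ * _)%:R) => a1
  a2 a3 a4 a5.
move: (ln N%:R) (ln k%:R) (ln (d - k)%:R) (ln (N - d)%:R) => b1 b2 b3 b4.
move: (N%:R) ((N - d)%:R) (k%:R) ((d - k)%:R) => n x p m.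
move=> *; apply/andP; split; lra.
Qed.

End Multinomial.

(** * Asymptotics of the deficit *)

Lemma cells_full n m : (n <= m)%N -> cells n m = (2 ^ n)%N.
Proof.
elim: n m => [//|n IH] [//|m] nm.
by rewrite cells_rec (IH m)// (IH m.+1) ?(ltnW nm)// expnS mul2n addnn.
Qed.

Lemma cells_compl n m : (0 < n)%N -> (m <= n)%N -> (cells n m + cells n (n - m) = 2 ^ n)%N.
Proof.
elim: n m => [//|n IH] [|m] _ mn;
  first by rewrite subn0 (cells_full (leqnn n.+1))/= big_ord0 muln0.
have [->|mn'] := eqVneq m n; first by rewrite subnn (cells_full (leqnn n.+1))/= big_ord0
  muln0 addn0.
have {mn mn'}mn : (m < n)%N by rewrite ltn_neqAle mn'.
have n0 : (0 < n)%N by apply: leq_ltn_trans mn.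
have h1 := IH m.+1 n0 mn; have := IH m n0 (ltnW mn).
rewrite subSS -(subnSK mn) !cells_rec expnS; lia.
Qed.

Lemma leq_cells n m m' : (m <= m')%N -> (cells n m <= cells n m')%N.
Proof.
case: n => [//|n] mm'; rewrite /= leq_mul2l/= -(subnKC mm') big_split_ord/=.
exact: leq_addr.
Qed.

Lemma cells_le n m : (cells n m <= 2 ^ n)%N.
Proof.
have [nm|/ltnW mn] := leqP n m; first by rewrite cells_full.
by rewrite -(cells_full (leqnn n)) leq_cells.
Qed.

(** For [N <= 2 d] the complementary count [cells N (N - d)] is at most [cells N d]. Hence the
    normalizing probability is at least one half. *)
Lemma cells_ge N d : (0 < N)%N -> (d < N)%N -> (N <= d.*2)%N -> (2 ^ N <= (cells N d).*2)%N.
Proof.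
move=> N0 dN Nd; rewrite -(cells_compl N0 (ltnW dN)) -addnn leq_add2l.
by apply: leq_cells; rewrite leq_subLR addnn.
Qed.

Section Cells.
Context {R : realType}.

Section CellsDiff.
Variables n m : nat.

(** With [n.+1 = N - k] and [m = d - k] this is the difference that governs the deficit. *)
Let D k : R := (cells (n + k).+1 (m + k))%:R - 2 ^+ k * (cells n.+1 m)%:R.

Let D0 : D 0 = 0.
Proof. by rewrite /D !addn0 expr0 mul1r subrr. Qed.

Let DS j : D j.+1 = 2 * D j + 2 * 'C(n + j, m + j)%:R.
Proof.
have cS : (cells (n + j).+2 (m + j).+1 = 2 * cells (n + j).+1 (m + j) + 2 * 'C(n + j, m + j))%N.
  rewrite cells_rec [X in (X + _)%N](_ : _ = cells (n + j).+1 (m + j) + 2 * 'C(n + j, m + j))%N.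
    by rewrite addnAC addnn -mul2n.
  by rewrite /= big_ord_recr/= mulnDr.
by rewrite /D !addnS cS natrD !natrM exprS; ring.
Qed.

Lemma cells_diff_ge k : (0 < k)%N ->
  2 ^+ k * 'C(n, m)%:R <= (cells (n + k).+1 (m + k))%:R - 2 ^+ k * (cells n.+1 m)%:R :> R.
Proof.
case: k => // k _; rewrite -/(D k.+1); elim: k => [|j IH].
  by rewrite DS D0 !addn0 expr1; lra.
rewrite DS exprS -mulrA.
have : 0 <= 'C(n + j.+1, m + j.+1)%:R :> R by [].
lra.
Qed.

(* Going from [k] to [k + 1] multiplies the difference by two and adds
   [2 * 'C(n + k, m + k)], and these binomials grow at most like [(2 q) ^+ k]. *)
Lemma cells_diff_le (k : nat) (q : R) : (m <= n)%N ->
  (n.+1%:R : R) <= 2 * q * m.+1%:R -> q < 1 ->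
  (cells (n + k).+1 (m + k))%:R - 2 ^+ k * (cells n.+1 m)%:R
    <= 2 ^+ k * 'C(n, m)%:R / (1 - q).
Proof.
move=> mn hq q1.
have q0 : 0 < q.
  have : 0 < 2 * q * m.+1%:R by apply: lt_le_trans hq; rewrite ltr0n.
  by rewrite pmulr_lgt0// pmulr_rgt0.
have C0 : 0 <= 'C(n, m)%:R :> R by [].
have binq j : 'C(n + j, m + j)%:R <= (2 * q) ^+ j * 'C(n, m)%:R.
  elim: j => [|j IH]; first by rewrite !addn0 expr0 mul1r.
  have := mul_bin_diag (n + j).+1 (m + j); rewrite /= => /(congr1 (fun i => i%:R : R)).
  rewrite !natrM !addnS => e.
  have mj : 0 < (m + j).+1%:R :> R by rewrite ltr0n.
  rewrite -(ler_pM2l mj) -e exprS.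
  (* The ratio bound persists as [j] grows because [2 * q] is at least 1. *)
  have h : (n + j).+1%:R <= (m + j).+1%:R * (2 * q).
    have m0 : 0 < m.+1%:R :> R by rewrite ltr0n.
    have q2 : 1 <= 2 * q.
      rewrite -(ler_pM2r m0) mul1r; apply: le_trans hq; rewrite ler_nat ltnS//.
    rewrite -!addSn !natrD mulrDl mulrC lerD// ler_peMr//.
  apply: le_trans (ler_wpM2r (ler0n R _) h) _.
  by rewrite -[leLHS]mulrA ler_pM2l// -[leRHS]mulrA ler_pM2l ?mulr_gt0.
(* The factor is the geometric sum of the first [j] powers of [q], which closes the induction. *)
have Dup j : D j <= 2 ^+ j * 'C(n, m)%:R * ((1 - q ^+ j) / (1 - q)).
  elim: j => [|j IH]; first by rewrite D0 expr0 subrr mul0r mulr0.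
  rewrite DS; apply: le_trans (lerD (ler_wpM2l _ IH) (ler_wpM2l _ (binq j))) _ => //.
  rewrite exprMn [in leRHS]exprS [q ^+ j.+1]exprS.
  rewrite le_eqVlt; apply/orP; left; apply/eqP; field.
  lra.
rewrite -/(D k); apply: le_trans (Dup k) _; rewrite ler_wpM2l ?mulr_ge0 ?exprn_ge0//.
rewrite ler_pdivrMr ?subr_gt0// mulVf ?gt_eqF ?subr_gt0// gerBl exprn_ge0// ltW//.
Qed.

End CellsDiff.

End Cells.

Section DeficitBounds.
Context {R : realType}.

Definition deficit (N d k : nat) : R :=
  'C(N, k)%:R - 'C(N, k)%:R * ((cells (N - k) (d - k))%:R / 2 ^+ (N - k)) /
   ((cells N d)%:R / 2 ^+ N).

Let deficitE (N d k : nat) : (0 < k < d)%N -> (d < N)%N ->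
  deficit N d k = 'C(N, k)%:R *
    ((cells N d)%:R - 2 ^+ k * (cells (N - k) (d - k))%:R) / (cells N d)%:R.
Proof.
move=> /andP[k0 kd] dN; rewrite /deficit.
have -> : 2 ^+ N = 2 ^+ (N - k) * 2 ^+ k :> R.
  by rewrite -exprD subnK// ltnW// (ltn_trans kd).
have c0 : (cells N d)%:R != 0 :> R by rewrite pnatr_eq0 -lt0n cells_gt0// (ltn_trans k0).
have p0 (j : nat) : 2 ^+ j != 0 :> R by rewrite expf_neq0// pnatr_eq0.
move: (2 ^+ (N - k)) (p0 (N - k)%N) (2 ^+ k) (p0 k) => a a0 b b0.
by field; rewrite a0 b0 c0.
Qed.

Let diff_ge (N d k : nat) : (0 < k < d)%N -> (d < N)%N ->
  2 ^+ k * 'C((N - k).-1, d - k)%:R <=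
  (cells N d)%:R - 2 ^+ k * (cells (N - k) (d - k))%:R :> R.
Proof.
move=> /andP[k0 kd] dN; have kN := ltn_trans kd dN.
have := @cells_diff_ge R (N - k).-1 (d - k) k k0.
by rewrite -addSn prednK ?subn_gt0// !subnK// ltnW.
Qed.

Let diff_le (N d k : nat) (q : R) : (0 < k < d)%N -> (d < N)%N ->
  (N - k)%:R <= 2 * q * (d - k).+1%:R -> q < 1 ->
  (cells N d)%:R - 2 ^+ k * (cells (N - k) (d - k))%:R <=
  2 ^+ k * 'C((N - k).-1, d - k)%:R / (1 - q).
Proof.
move=> /andP[k0 kd] dN hq q1; have kN := ltn_trans kd dN.
have := @cells_diff_le R (N - k).-1 (d - k) k q.
rewrite -addSn prednK ?subn_gt0// !subnK ?(ltnW kd) ?(ltnW kN)//; apply => //.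
by rewrite -ltnS prednK ?subn_gt0// ltn_sub2r.
Qed.

Lemma deficit_gt0 (N d k : nat) : (0 < k < d)%N -> (d < N)%N -> 0 < deficit N d k.
Proof.
move=> kd dN; rewrite deficitE//; have /andP[k0 kd'] := kd; have kN := ltn_trans kd' dN.
have cp : 0 < (cells N d)%:R :> R by rewrite ltr0n cells_gt0// (ltn_trans k0).
rewrite divr_gt0// mulr_gt0 ?ltr0n ?bin_gt0 ?(ltnW kN)//.
apply: lt_le_trans (diff_ge kd dN); rewrite mulr_gt0 ?exprn_gt0// ltr0n bin_gt0.
by rewrite -ltnS prednK ?subn_gt0// ltn_sub2r.
Qed.

(** The deficit lies between [y] and [2 / (1 - q) * y] times [M / 2 ^+ (N - k)]. The 2 comes from
    [cells_ge], [1 - q] from the geometric sum, and the exponentials from the Stirling bounds. *)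
Lemma deficit_asymptotics (N d k : nat) (q e : R) : (0 < k < d)%N -> (d < N)%N ->
  (N <= d.*2)%N -> (N - k)%:R <= 2 * q * (d - k).+1%:R -> q < 1 -> 0 < e ->
  e <= (N - d)%:R / N%:R -> e <= k%:R / N%:R -> e <= (d - k)%:R / N%:R ->
  e * expR (- 3) <=
  deficit N d k * N%:R * expR (- (N%:R * threshold_exponent (d%:R / N%:R) (k%:R / d%:R)))
  <= 2 / (1 - q) * expR (1 - 3 / 2 * ln e).
Proof.
move=> kd dN Nd hq q1 e0 ex ek em; rewrite deficitE//.
have /andP[k0 kd'] := kd; have kN := ltn_trans kd' dN.
have d0 := ltn_trans k0 kd'; have N0 := ltn_trans d0 dN.
have Np : 0 < N%:R :> R by rewrite ltr0n.
have cp : 0 < (cells N d)%:R :> R by rewrite ltr0n cells_gt0.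
have c1 : (cells N d)%:R <= 2 ^+ N :> R by rewrite -natrX ler_nat cells_le.
have c2 : 2 ^+ N <= 2 * (cells N d)%:R :> R by rewrite -natrX -natrM ler_nat mul2n cells_ge.
have D1 := diff_ge kd dN; have D2 := diff_le kd dN hq q1.
set D := _ - _ in D1 D2 *.
set M : R := ('C(N, k) * 'C(N - k, d - k))%:R.
have M0 : 0 < M by rewrite ltr0n muln_gt0 !bin_gt0 (ltnW kN) leq_sub2r// ltnW.
(* The factor between ['C((N - k).-1, d - k)] and ['C(N - k, d - k)]. *)
set y : R := (N - d)%:R / (N - k)%:R.
have Nkp : 0 < (N - k)%:R :> R by rewrite ltr0n subn_gt0.
have ye : e <= y.
  apply: le_trans ex _; rewrite ler_pM2l ?ltr0n ?subn_gt0// lef_pV2 ?posrE// ler_nat leq_subr//.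
have y1 : y <= 1 by rewrite ler_pdivrMr// mul1r ler_nat leq_sub2l// ltnW.
have binE : 'C(N, k)%:R * 'C((N - k).-1, d - k)%:R = M * y :> R.
  rewrite /M /y natrM -mulrA; congr (_ * _); apply: (mulfI (lt0r_neq0 Nkp)).
  rewrite -natrM mul_bin_down natrM mulrCA [_ * (_ / _)]mulrCA mulfV ?lt0r_neq0// mulr1 mulrC.
  by congr (_ * _%:R); rewrite subnBA ?subnK// ltnW.
have p0 (j : nat) : 0 < 2 ^+ j :> R by rewrite exprn_gt0.
have pN : 2 ^+ N = 2 ^+ (N - k) * 2 ^+ k :> R by rewrite -exprD subnK// ltnW.
set G := N%:R * _; pose W : R := M / 2 ^+ (N - k) * N%:R * expR (- G).
have W0 : 0 < W by rewrite !mulr_gt0 ?invr_gt0 ?expR_gt0.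
(* Beyond the Stirling error, [ln W] is half the sum of [ln N - ln z] for [z] equal to [N - d], [k]
   and [d - k]; each difference is between 0 and [- ln e]. *)
have WE : -3 <= ln W <= 1 - 3 / 2 * ln e.
  have lnW : ln W = ln M - (N - k)%:R * ln 2 + ln N%:R - G.
    rewrite /W !lnM ?posrE ?mulr_gt0 ?invr_gt0 ?expR_gt0// expRK.
    by rewrite lnV ?posrE// lnXn// mulr_natl.
  have /andP[] := @ln_multinomial R N d k kd dN; rewrite -/M => l1 l2.
  have lnle (z : nat) : (0 < z)%N -> (z <= N)%N -> e <= z%:R / N%:R ->
      ln e <= ln (z%:R : R) - ln (N%:R : R) <= 0.
    move=> z0 zN ez; have zp : 0 < z%:R :> R by rewrite ltr0n.
    rewrite -{1}ln_div ?posrE// ler_ln ?posrE// ?divr_gt0// ez/=.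
    by rewrite subr_le0 ler_ln ?posrE// ler_nat.
  have x0 : (0 < N - d)%N by rewrite subn_gt0.
  have m0 : (0 < d - k)%N by rewrite subn_gt0.
  have /andP[] := lnle _ x0 (leq_subr _ _) ex.
  have /andP[] := lnle k k0 (ltnW kN) ek.
  have /andP[] := lnle _ m0 (leq_trans (leq_subr _ _) (ltnW dN)) em.
  rewrite lnW /G threshold_exponentE//.
  move: l1 l2; move: (ln M) (ln e) (ln N%:R) (ln (N - d)%:R) (ln k%:R) (ln (d - k)%:R) (ln 2).
  move: (N%:R) ((N - d)%:R) (k%:R) ((d - k)%:R) ((N - k)%:R) => z1 z2 z3 z4 z5 y1' y2 y3
    y4 y5 y6 y7 *.
  by apply/andP; split; lra.
have /andP[W1 W2] : expR (- 3) <= W <= expR (1 - 3 / 2 * ln e).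
  by move: WE; rewrite -{3 4}(lnK W0) !ler_expR.
have q1' : 0 < 1 - q by rewrite subr_gt0.
have y0 : 0 < y by apply: lt_le_trans ye.
have low : y * (M / 2 ^+ (N - k)) <= 'C(N, k)%:R * D / (cells N d)%:R.
  rewrite ler_pdivlMr//; apply: (@le_trans _ _ (M * y * 2 ^+ k)).
    have -> : M * y * 2 ^+ k = y * (M / 2 ^+ (N - k)) * 2 ^+ N.
      by rewrite pN; field; rewrite lt0r_neq0.
    by rewrite ler_pM2l// mulr_gt0// divr_gt0.
  by rewrite -binE -mulrA ler_wpM2l// mulrC.
have up : 'C(N, k)%:R * D / (cells N d)%:R <= 2 / (1 - q) * (y * (M / 2 ^+ (N - k))).
  rewrite ler_pdivrMr//; apply: (@le_trans _ _ (M * y * 2 ^+ k / (1 - q))).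
    by rewrite -binE -!mulrA ler_wpM2l// mulrCA mulrA.
  have -> : M * y * 2 ^+ k / (1 - q) = (y * (M / 2 ^+ (N - k)) / (1 - q)) * 2 ^+ N.
    by rewrite pN; field; rewrite !lt0r_neq0.
  have -> : 2 / (1 - q) * (y * (M / 2 ^+ (N - k))) * (cells N d)%:R =
      (y * (M / 2 ^+ (N - k)) / (1 - q)) * (2 * (cells N d)%:R).
    by field; rewrite !lt0r_neq0.
  by rewrite ler_pM2l// divr_gt0// mulr_gt0// divr_gt0.
apply/andP; split.
  apply: (@le_trans _ _ (y * W)).
    by apply: ler_pM => //; exact: ltW.
  by rewrite /W !mulrA ler_pM2r ?expR_gt0// ler_pM2r// -mulrA.
apply: (@le_trans _ _ (2 / (1 - q) * (y * W))).
  have -> : 2 / (1 - q) * (y * W) =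
      2 / (1 - q) * (y * (M / 2 ^+ (N - k))) * N%:R * expR (- G) by rewrite /W; ring.
  by rewrite ler_pM2r ?expR_gt0// ler_pM2r.
rewrite ler_pM2l ?divr_gt0 ?subr_gt0//; apply: le_trans W2.
by rewrite ler_piMl// ltW.
Qed.

End DeficitBounds.

(** * The threshold *)

Section Threshold.
Context {R : realType}.
Implicit Types a t u x : R.

(* The tangent line bound [a * ln (m / a) <= m - a] at the mean [m]. *)
Lemma xlnx_convex x y t : 0 <= x -> 0 <= y -> 0 <= t <= 1 ->
  ((1 - t) * x + t * y) * ln ((1 - t) * x + t * y) <= (1 - t) * (x * ln x) + t * (y * ln y).
Proof.
move=> x0 y0 /andP[t0 t1]; set m := (1 - t) * x + t * y.
have tangent z : 0 <= z -> 0 < m -> z * ln m + (z - m) <= z * ln z.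
  move=> z0 m0; have [->|zn0] := eqVneq z 0; first by rewrite !mul0r; lra.
  have zp : 0 < z by rewrite lt_neqAle eq_sym zn0.
  have := @le_ln1Dx R (m / z - 1);
    rewrite addrCA subrr addr0 ltrBrDl subrr divr_gt0// => /(_ isT).
  rewrite ln_div ?posrE// -(ler_pM2l zp) mulrBr mulrBr mulrCA mulfV// !mulr1.
  lra.
have : 0 <= m by rewrite addr_ge0// mulr_ge0// subr_ge0.
rewrite le_eqVlt => /predU1P[m0|m0].
  have /eqP : (1 - t) * x + t * y = 0 by rewrite -/m -m0.
  rewrite paddr_eq0 ?mulr_ge0 ?subr_ge0// => /andP[/eqP h1 /eqP h2].
  by rewrite -m0 mul0r !mulrA h1 h2 !mul0r addr0.
have hx := tangent x x0 m0; have hy := tangent y y0 m0.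
have t1' : 0 <= 1 - t by rewrite subr_ge0.
have := lerD (ler_wpM2l t1' hx) (ler_wpM2l t0 hy).
apply: le_trans; rewrite le_eqVlt; apply/orP; left; apply/eqP.
by rewrite /m; ring.
Qed.

(** The chords end at 1, where the exponent is positive. Up to a function affine in the second
    argument, the exponent is [u] times an entropy, to which [xlnx_convex] applies. *)
Lemma threshold_exponent_concave u a t : 0 <= u -> 0 <= a <= 1 -> 0 <= t <= 1 ->
  (1 - t) * threshold_exponent u a + t * threshold_exponent u 1 <=
  threshold_exponent u ((1 - t) * a + t).
Proof.
move=> u0 /andP[a0 a1] t01; rewrite /threshold_exponent /binary_entropy subrr.
have h1 := @xlnx_convex a 1 t a0 ler01 t01.
have a1' : 0 <= 1 - a by rewrite subr_ge0.
have h2 := @xlnx_convex (1 - a) 0 t a1' (lexx _) t01.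
rewrite !mulr1 ln1 !mulr0 addr0 in h1; rewrite !mulr0 addr0 mul0r mulr0 addr0 in h2.
have e : 1 - ((1 - t) * a + t) = (1 - t) * (1 - a) by ring.
rewrite e.
have h := ler_wpM2l u0 (lerD h1 h2).
rewrite ln1 !mul0r; move: h; rewrite -subr_ge0 => h; rewrite -subr_ge0.
apply: le_trans h _; rewrite le_eqVlt; apply/orP; left; apply/eqP; ring.
Qed.

(* Concavity on [[x, 1]] beats an error of at most [(y - x) ^+ 2] at an end point
   of [[x, y]], because the value at [1] exceeds [c]. *)
Lemma threshold_exponent_le0_below (u x y c s : R) :
  0 <= u -> 0 <= x -> y < 1 -> 0 < s -> s <= y - x -> y - x <= c / 2 ->
  c < threshold_exponent u 1 -> threshold_exponent u y <= s ^+ 2 ->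
  threshold_exponent u x <= 0.
Proof.
move=> u0 x0 y1 s0 sxy xyc hc hy; rewrite leNgt; apply/negP => Gx.
have c0 : 0 < c by lra.
have x1 : 0 < 1 - x by lra.
pose t := (y - x) / (1 - x).
have t0 : y - x <= t by rewrite ler_pdivlMr//; nra.
have t1 : t <= 1 by rewrite ler_pdivrMr//; lra.
have tE : (1 - t) * x + t = y by rewrite /t; field; rewrite gt_eqF.
have := @threshold_exponent_concave u x t u0; rewrite tE x0 t1 (_ : x <= 1); last by lra.
rewrite (_ : 0 <= t); last by lra.
move=> /(_ isT isT).
have : 0 <= (1 - t) * threshold_exponent u x.
  by apply: mulr_ge0; [rewrite subr_ge0|exact: ltW].
have : t * c < t * threshold_exponent u 1 by rewrite ltr_pM2l//; lra.
have : (y - x) * c <= t * c by rewrite ler_pM2r.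
have : s ^+ 2 <= (y - x) ^+ 2 by rewrite ler_sqr ?nnegrE//; lra.
have : (y - x) ^+ 2 < (y - x) * c by rewrite expr2 ltr_pM2l; lra.
lra.
Qed.

(** The chord from [x] to 1 gains at least [(y - x) * c] at [y], and the error [s ^+ 2] costs at
    most half of it. *)
Lemma threshold_exponent_ge_above (u x y c s : R) :
  0 <= u -> 0 <= x -> y < 1 -> 0 < s -> s <= y - x -> y - x <= c / 2 ->
  c < threshold_exponent u 1 -> `|threshold_exponent u x| <= s ^+ 2 ->
  c / 2 * s <= threshold_exponent u y.
Proof.
move=> u0 x0 y1 s0 sxy xyc hc; rewrite ler_norml => /andP[hx _].
have c0 : 0 < c by lra.
have x1 : 0 < 1 - x by lra.
pose t := (y - x) / (1 - x).
have t0 : y - x <= t by rewrite ler_pdivlMr//; nra.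
have t1 : t <= 1 by rewrite ler_pdivrMr//; lra.
have tE : (1 - t) * x + t = y by rewrite /t; field; rewrite gt_eqF.
have := @threshold_exponent_concave u x t u0; rewrite tE x0 t1 (_ : x <= 1); last by lra.
rewrite (_ : 0 <= t); last by lra.
move=> /(_ isT isT).
have : 0 <= (1 - t) * (threshold_exponent u x + s ^+ 2) by rewrite mulr_ge0 ?subr_ge0//; lra.
have : 0 <= t * s ^+ 2 by rewrite mulr_ge0 ?sqr_ge0//; lra.
have : t * c < t * threshold_exponent u 1 by rewrite ltr_pM2l//; lra.
have : (y - x) * c <= t * c by rewrite ler_pM2r.
have : s ^+ 2 <= (y - x) ^+ 2 by rewrite ler_sqr ?nnegrE//; lra.
have : (y - x) ^+ 2 <= (y - x) * (c / 2) by rewrite expr2 ler_wpM2l; lra.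
have : c / 2 * s <= c / 2 * (y - x) by rewrite ler_wpM2l//; lra.
lra.
Qed.

(** The value is [- u ln u - (1 - u) ln (2 (1 - u))], and both logarithms are negative. *)
Lemma threshold_exponent1_gt0 u : 1 / 2 < u < 1 -> 0 < threshold_exponent u 1.
Proof.
move=> /andP[u1 u2]; rewrite /threshold_exponent /binary_entropy subrr ln1 mul0r.
have l1 : ln u < 0.
  by rewrite ln_lt0// u2 andbT; lra.
have l2 : ln (1 - u) < - ln 2.
  by rewrite -lnV ?posrE// ltr_ln ?posrE ?subr_gt0//; lra.
have : 0 < - u * ln u by rewrite nmulr_rgt0//; lra.
have : (1 - u) * ln (1 - u) < (1 - u) * - ln 2 by rewrite ltr_pM2l// subr_gt0.
lra.
Qed.

Lemma cvg_binary_entropy (T : Type) (F : set_system T) (FF : Filter F) (u : T -> R) a :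
  0 < a < 1 -> u @ F --> a -> (fun n => binary_entropy (u n)) @ F --> binary_entropy a.
Proof.
move=> /andP[a0 a1] ua; rewrite /binary_entropy.
have ln_u : (fun n => ln (u n)) @ F --> ln a.
  by apply: (continuous_cvg _ _ ua); exact: continuous_ln.
have u1 : (fun n => 1 - u n) @ F --> 1 - a by apply: cvgB => //; exact: cvg_cst.
have ln_u1 : (fun n => ln (1 - u n)) @ F --> ln (1 - a).
  by apply: (continuous_cvg _ _ u1); apply: continuous_ln; rewrite subr_gt0.
by apply: cvgB; apply: cvgM => //; exact: cvgN.
Qed.

Lemma cvg_threshold_exponent (T : Type) (F : set_system T) (FF : Filter F) (u v : T -> R)
  (a b : R) :
  0 < a < 1 -> 0 < b < 1 -> u @ F --> a -> v @ F --> b ->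
  (fun n => threshold_exponent (u n) (v n)) @ F --> threshold_exponent a b.
Proof.
move=> a01 b01 ua vb; rewrite /threshold_exponent.
have ha := cvg_binary_entropy FF a01 ua; have hb := cvg_binary_entropy FF b01 vb.
apply: cvgB; first by apply: cvgD => //; exact: cvgM.
apply: cvgMl; apply: cvgB; [exact: cvg_cst|exact: cvgM].
Qed.

Section Sign.
Variable delta : R.
Hypothesis hdelta : 1 / 2 < delta < 1.
Local Notation G := (threshold_exponent delta).

(** The point [(x, G x)] lies on or above the chord from [z] to 1, so once [G] is nonnegative it is
    positive from there on. *)
Lemma threshold_exponent_gt0 z x : 0 <= z -> z < x -> x < 1 -> 0 <= G z -> 0 < G x.
Proof.
move=> z0 zx x1 Gz; have G1 := threshold_exponent1_gt0 hdelta.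
pose t := (x - z) / (1 - z).
have z1 : 0 < 1 - z by lra.
have t0 : 0 < t by rewrite divr_gt0//; lra.
have t1 : t <= 1 by rewrite ler_pdivrMr//; lra.
have xE : x = (1 - t) * z + t by rewrite /t; field; rewrite gt_eqF.
have u0 : 0 <= delta by have /andP[] := hdelta; lra.
rewrite xE; apply: lt_le_trans (threshold_exponent_concave u0 _ _); last 2 first.
- by apply/andP; split; lra.
- by rewrite t1 ltW.
by apply: ltr_wpDl; [rewrite mulr_ge0// subr_ge0|rewrite mulr_gt0].
Qed.

Lemma rho_S_zero z : 0 <= z <= 1 -> G z = 0 -> 0 <= rho_S delta <= 1 /\ G (rho_S delta) = 0.
Proof. by move=> z01 Gz; have := @xgetI _ 0 [set x | 0 <= x <= 1 /\ G x = 0] z (conj z01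
  Gz). Qed.

Lemma threshold_exponent_lt0 x : 0 < x -> x < rho_S delta -> G x < 0.
Proof.
move=> x0 xS; rewrite ltNge; apply/negP => Gx.
have [/andP[S0 S1] GS] : 0 <= rho_S delta <= 1 /\ G (rho_S delta) = 0.
  (* Without a zero, [rho_S delta] would be the default 0, contrary to [0 < x < rho_S delta]. *)
  have [[z [z01 Gz]]|/forallNP h] := pselect (exists z, 0 <= z <= 1 /\ G z = 0).
    exact: rho_S_zero Gz.
  by move: xS; rewrite /rho_S xgetPN// ltNge ltW.
have G1 := threshold_exponent1_gt0 hdelta.
have : rho_S delta < 1.
  rewrite lt_neqAle S1 andbT; apply: contraTneq G1 => S1'.
  by rewrite -S1' GS ltxx.
by move=> /(threshold_exponent_gt0 (ltW x0) xS)/(_ Gx); rewrite GS ltxx.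
Qed.

Lemma threshold_exponent_gt_rho_S x : 0 < x < 1 -> rho_S delta < x -> 0 < G x.
Proof.
move=> /andP[x0 x1] Sx; rewrite ltNge; apply/negP => Gx.
have G1 := threshold_exponent1_gt0 hdelta.
(* By concavity [G] is positive somewhere below [1], where it is continuous. *)
have [y /andP[xy y1] Gy] : exists2 y, x < y < 1 & 0 < G y.
  (* At parameter [t] the chord from [G x] to [G 1 / 2] crosses 0; [t'] lies strictly between [t]
     and 1. *)
  pose t := - G x / (- G x + G 1 / 2).
  have den : 0 < - G x + G 1 / 2 by lra.
  have t0 : 0 <= t by rewrite divr_ge0 ?oppr_ge0// ltW.
  have t1 : t < 1 by rewrite ltr_pdivrMr//; lra.
  pose t' := (1 + t) / 2.
  have t'0 : 0 < t' by rewrite /t'; lra.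
  have t'1 : t' < 1 by rewrite /t'; lra.
  have tt' : t < t' by rewrite /t'; lra.
  exists ((1 - t') * x + t').
    have : 0 < t' * (1 - x) by rewrite mulr_gt0//; lra.
    have : 0 < (1 - t') * (1 - x) by rewrite mulr_gt0//; lra.
    by move=> *; apply/andP; split; lra.
  have u0 : 0 <= delta by have /andP[] := hdelta; lra.
  apply: lt_le_trans (threshold_exponent_concave u0 _ _); last 2 first.
  - by apply/andP; split; lra.
  - by apply/andP; split; lra.
  have : t * (- G x + G 1 / 2) = - G x by rewrite /t divfK// gt_eqF.
  have : 0 < (t' - t) * (- G x + G 1 / 2) by rewrite mulr_gt0// subr_gt0.
  have : 0 < t' * (G 1 / 2) by rewrite mulr_gt0// divr_gt0.
  lra.
have Gcont : {within `[x, y], continuous G}.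
  apply: continuous_in_subspaceT => w; rewrite inE/= in_itv/= => /andP[xw wy].
  apply: cvg_threshold_exponent; [| |exact: cvg_cst|exact: cvg_id].
    by have /andP[] := hdelta; move=> *; apply/andP; split; lra.
  by apply/andP; split; lra.
(* A zero exists, so [rho_S delta] is a genuine zero and [G] is positive to its right. *)
have [|z] := IVT (v := 0) (ltW xy) Gcont.
  by rewrite ge_min Gx le_max (ltW Gy) orbT.
rewrite in_itv/= => /andP[xz zy] Gz.
have [|/andP[S0 S1] GS] := @rho_S_zero z _ Gz; first by apply/andP; split; lra.
have := threshold_exponent_gt0 S0 Sx x1; rewrite GS lexx => /(_ isT).
by rewrite ltNge Gx.
Qed.

End Sign.

End Threshold.

(** * Limits along admissible sequences *)

Section Sequences.
Context {R : realType}.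

(** The finitely many exceptional values are positive; they are absorbed into the bounds one at a
    time. *)
Lemma eventually_bounded (h : nat -> R) (m : nat) :
  (forall n, (m <= n)%N -> 0 < h n) ->
  (exists a b : R, 0 < a /\ \forall n \near \oo, a <= h n <= b) ->
  exists a b : R, [/\ 0 < a, a <= b & forall n, (m <= n)%N -> a <= h n <= b].
Proof.
move=> h0 [a [b [a0 [D _ hD]]]].
suff [a' [b' [a'0 hab]]] : exists a b : R, 0 < a /\ forall n, (m <= n)%N -> a <= h n <= b.
  exists a', b'; split=> //; have /andP[h1 h2] := hab m (leqnn m).
  exact: le_trans h1 h2.
have {hD} : forall n, (D <= n)%N -> (m <= n)%N -> a <= h n <= b by move=> n Dn _; exact: hD.
elim: D a b a0 => [|D IH] a b a0 hD; first by exists a, b; split=> // n; exact: hD.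
have [mD|Dm] := leqP m D; last first.
  apply: (IH a b) => // n _ mn; apply: hD => //; exact: leq_trans mn.
apply: (IH (Num.min a (h D)) (Num.max b (h D))); first by rewrite lt_min a0 h0.
move=> n; rewrite leq_eqVlt => /predU1P[<- _|Dn mn].
  by rewrite ge_min le_max lexx !orbT.
have /andP[h1 h2] := hD n Dn mn.
by rewrite ge_min le_max h1 h2.
Qed.

Section Admissible.
Variables (delta rho : R) (k N : nat -> nat).
Hypotheses (hdelta : 1 / 2 < delta < 1) (hrho : 0 < rho < 2 - 1 / delta).
Hypothesis adm : admissible delta rho k N.

Let u (d : nat) : R := d%:R / (N d)%:R.
Let v (d : nat) : R := (k d)%:R / d%:R.
Let G (d : nat) : R := threshold_exponent (u d) (v d).
Let r (d : nat) : R := deficit (N d) d (k d).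

(** The function [h] of the theorem. *)
Definition normalized_deficit (d : nat) : R :=
  r d * (N d)%:R * expR (- ((N d)%:R * G d)).

Lemma rho_lt1 : rho < 1.
Proof.
have /andP[d1 d2] := hdelta; have /andP[r0 r1] := hrho.
have d0 : 0 < delta by lra.
have : 1 < 1 / delta by rewrite ltr_pdivlMr// mul1r.
lra.
Qed.

Let adm_nat d : (2 <= d)%N -> (0 < k d < d)%N /\ (d < N d)%N.
Proof. by have [h _ _] := adm => /h[-> -> ->]. Qed.

Lemma normalized_deficit_gt0 d : (2 <= d)%N -> 0 < normalized_deficit d.
Proof.
move=> /adm_nat[kd dN]; rewrite /normalized_deficit !mulr_gt0 ?expR_gt0 ?deficit_gt0//.
by rewrite ltr0n (leq_ltn_trans _ dN).
Qed.

Lemma normalized_deficit_eventually :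
  exists a b : R, 0 < a /\ \forall d \near \oo, a <= normalized_deficit d <= b.
Proof.
have [_ ud vd] := adm.
have /andP[d1 d2] := hdelta; have /andP[r0 r1] := hrho; have r2 := rho_lt1.
have d0 : 0 < delta by lra.
have uv : (fun d => u d * v d) @ \oo --> delta * rho by apply: cvgM.
have u1 : (fun d => 1 - u d) @ \oo --> 1 - delta by apply: cvgB => //; exact: cvg_cst.
have uv1 : (fun d => u d - u d * v d) @ \oo --> delta - delta * rho by exact: cvgB.
have dr0 : 0 < delta * rho by rewrite mulr_gt0.
have dr1 : 0 < delta - delta * rho.
  by rewrite -[X in X - _]mulr1 -mulrBr mulr_gt0// subr_gt0.
have hr : 1 - delta * rho < 2 * (delta - delta * rho).
  have : rho * delta < 2 * delta - 1.
    have -> : 2 * delta - 1 = (2 - 1 / delta) * delta by field; rewrite gt_eqF.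
    by rewrite ltr_pM2r.
  lra.
(* The midpoint between 1 and the limit of [(N - k) / (2 * (d - k))]; that limit is below 1
   precisely because [rho < 2 - 1 / delta]. *)
pose q := (1 + (1 - delta * rho) / (2 * (delta - delta * rho))) / 2.
have q0 : (1 - delta * rho) / (2 * (delta - delta * rho)) < 1.
  by rewrite ltr_pdivrMr// ?mul1r// mulr_gt0.
have q1 : q < 1 by rewrite /q; lra.
have q2 : 1 - delta * rho < 2 * q * (delta - delta * rho).
  have : (1 - delta * rho) / (2 * (delta - delta * rho)) < q by rewrite /q; lra.
  rewrite ltr_pdivrMr ?mulr_gt0//; lra.
have q3 : (fun d => 2 * q * (u d - u d * v d) - (1 - u d * v d)) @ \oo -->
    2 * q * (delta - delta * rho) - (1 - delta * rho).
  apply: cvgB; first by apply: cvgMr.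
  by apply: cvgB => //; exact: cvg_cst.
(* Half the smallest of the limits of [(N - d) / N], [k / N] and [(d - k) / N]. *)
pose e := Num.min ((1 - delta) / 2) (Num.min (delta * rho / 2) ((delta - delta * rho) / 2)).
have e0 : 0 < e by rewrite !lt_min !divr_gt0//; lra.
exists (e * expR (- 3)), (2 / (1 - q) * expR (1 - 3 / 2 * ln e)).
split; first by rewrite mulr_gt0 ?expR_gt0.
near=> d.
have d2' : (2 <= d)%N by near: d; exact: nbhs_infty_ge.
have [kd dN] := adm_nat d2'; have /andP[k0 kd'] := kd.
have Nd0 : 0 < (N d)%:R :> R by rewrite ltr0n (leq_ltn_trans _ dN).
have dd0 : 0 < d%:R :> R by rewrite ltr0n (leq_trans _ d2').
have uvE : u d * v d = (k d)%:R / (N d)%:R.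
  by rewrite /u /v; field; rewrite !gt_eqF.
have u1E : 1 - u d = (N d - d)%:R / (N d)%:R.
  by rewrite /u (natrB _ (ltnW dN)); field; rewrite gt_eqF.
have uv1E : u d - u d * v d = (d - k d)%:R / (N d)%:R.
  by rewrite uvE /u (natrB _ (ltnW kd')); field; rewrite gt_eqF.
apply: deficit_asymptotics => //.
- have : 1 / 2 < u d by near: d; exact: (cvgr_gt _ ud).
  rewrite /u ltr_pdivlMr// => h; rewrite -(ler_nat R) -muln2 natrM; lra.
- have : 0 < 2 * q * (u d - u d * v d) - (1 - u d * v d).
    by near: d; apply: (cvgr_gt _ q3); rewrite subr_gt0.
  rewrite uv1E uvE subr_gt0 => h.
  have : (1 - (k d)%:R / (N d)%:R) * (N d)%:R < 2 * q * ((d - k d)%:R / (N d)%:R) * (N d)%:R.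
    by rewrite ltr_pM2r.
  rewrite mulrBl mul1r !divfK ?gt_eqF// -[2 * q * _ * _]mulrA divfK ?gt_eqF//.
  have qp : 0 < q.
    rewrite /q divr_gt0// addr_gt0// divr_gt0// ?mulr_gt0//.
    have : delta - delta * rho > 0 by []. lra.
  move=> h'; rewrite (natrB _ (ltnW (ltn_trans kd' dN))) -[X in 2 * q * X]natr1 mulrDr
    mulr1; lra.
- rewrite -u1E; apply: (@le_trans _ _ ((1 - delta) / 2)); first by rewrite ge_min lexx.
  by apply: ltW; near: d; apply: (cvgr_gt _ u1); lra.
- rewrite -uvE; apply: (@le_trans _ _ (delta * rho / 2)); first by rewrite !ge_min lexx orbT.
  by apply: ltW; near: d; apply: (cvgr_gt _ uv); lra.
- rewrite -uv1E; apply: (@le_trans _ _ ((delta - delta * rho) / 2)).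
    by rewrite !ge_min lexx !orbT.
  by apply: ltW; near: d; apply: (cvgr_gt _ uv1); lra.
Unshelve. all: by end_near.
Qed.

Lemma normalized_deficit_bounded : exists a b : R,
  [/\ 0 < a, a <= b & forall d, (2 <= d)%N -> a <= normalized_deficit d <= b].
Proof.
apply: eventually_bounded; [exact: normalized_deficit_gt0|exact: normalized_deficit_eventually].
Qed.

Lemma deficitE_normalized d : (2 <= d)%N ->
  r d = 1 / (N d)%:R * expR ((N d)%:R * G d) * normalized_deficit d.
Proof.
move=> d2; have [kd dN] := adm_nat d2.
have Nd0 : (N d)%:R != 0 :> R by rewrite pnatr_eq0 -lt0n (leq_ltn_trans _ dN).
have := expRxMexpNx_1 ((N d)%:R * G d); rewrite /normalized_deficit.
move: (expR _) (expR _) => x y xy.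
rewrite [RHS](_ : _ = r d * (y * x)); last by field.
by rewrite xy mulr1.
Qed.

Lemma deficit_le_of_exponent_le0 : exists b : R, forall d, (2 <= d)%N -> G d <= 0 -> r d
  <= b / d%:R.
Proof.
have [a [b [a0 ab hab]]] := normalized_deficit_bounded; exists b => d d2 Gd.
have [kd dN] := adm_nat d2; have /andP[h1 h2] := hab d d2.
have d0 : 0 < d%:R :> R by rewrite ltr0n (leq_trans _ d2).
have Nd0 : 0 < (N d)%:R :> R by rewrite ltr0n (leq_ltn_trans _ dN).
have b0 : 0 < b by apply: lt_le_trans ab.
rewrite deficitE_normalized// mul1r; apply: (@le_trans _ _ ((N d)%:R^-1 * b)).
  rewrite -mulrA ler_pM2l ?invr_gt0//.
  have e1 : expR ((N d)%:R * G d) <= 1.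
    by rewrite -[leRHS]expR0 ler_expR pmulr_rle0.
  apply: le_trans h2; rewrite -[leRHS]mul1r ler_wpM2r//.
  by rewrite ltW// normalized_deficit_gt0.
by rewrite [leLHS]mulrC ler_pM2l// lef_pV2 ?posrE// ler_nat ltnW.
Qed.

(** From [x ^+ 4 / 24 <= expR x]. The fourth power is high enough for the critical case: [s ^+ 2] of
    order [1 / N] still leaves a bound linear in [N]. *)
Lemma deficit_ge_of_exponent : exists2 a : R, 0 < a &
  forall d s, (2 <= d)%N -> 0 <= s -> s <= G d -> a * (N d)%:R ^+ 3 * s ^+ 4 <= r d.
Proof.
have [a [b [a0 ab hab]]] := normalized_deficit_bounded.
exists (a / 24); first by rewrite divr_gt0.
move=> d s d2 s0 sG.
have [kd dN] := adm_nat d2; have /andP[h1 h2] := hab d d2.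
have Nd0 : 0 < (N d)%:R :> R by rewrite ltr0n (leq_ltn_trans _ dN).
have e1 : ((N d)%:R * s) ^+ 4 / 24 <= expR ((N d)%:R * G d).
  apply: (@le_trans _ _ (expR ((N d)%:R * s))); last by rewrite ler_expR ler_pM2l.
  have := @expR_ge1Dxn R ((N d)%:R * s) 3 (mulr_ge0 (ltW Nd0) s0).
  rewrite (_ : 4`!%:R = 24)//; lra.
rewrite deficitE_normalized//.
apply: (@le_trans _ _ (1 / (N d)%:R * (((N d)%:R * s) ^+ 4 / 24) * a)).
  by rewrite le_eqVlt; apply/orP; left; apply/eqP; field; rewrite gt_eqF.
apply: ler_pM => //; last by rewrite ler_pM2l// mul1r invr_gt0.
- by rewrite mulr_ge0// divr_ge0// ?exprn_ge0// ?mulr_ge0// ltW.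
- exact: ltW.
Qed.

End Admissible.

End Sequences.

Lemma le1_2harmonic (R : realType) d : (1 <= d)%N -> 1 <= 2 * (harmonic d * d%:R) :> R.
Proof.
move=> d1; have d0 : 1 <= d%:R :> R by rewrite ler1n.
rewrite /= mulrCA ler_pdivlMl// mulr1 -natr1; lra.
Qed.

Section Limits.
Context {R : realType}.
Variables (delta rho : R).
Hypotheses (hdelta : 1 / 2 < delta < 1) (hrho : 0 < rho < 2 - 1 / delta).

Let delta01 : 0 < delta < 1.
Proof. by have /andP[] := hdelta; move=> *; apply/andP; split; lra. Qed.

Let rho01 : 0 < rho < 1.
Proof. by have /andP[-> _] := hrho; rewrite (rho_lt1 hdelta hrho). Qed.

Lemma cvg_deficit0 (k N : nat -> nat) : admissible delta rho k N -> rho < rho_S delta ->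
  (fun d => deficit (N d) d (k d) : R) @ \oo --> (0 : R).
Proof.
move=> adm rS; have [_ ud vd] := adm; have /andP[r0 r1] := rho01.
have G0 := threshold_exponent_lt0 hdelta r0 rS.
have Gd : (fun d => threshold_exponent (d%:R / (N d)%:R) ((k d)%:R / d%:R)) @ \oo -->
    threshold_exponent delta rho by exact: cvg_threshold_exponent.
have [b hb] := deficit_le_of_exponent_le0 hdelta hrho adm.
have h0 : (fun n => (2 * b) * harmonic n) @ \oo --> (0 : R).
  by rewrite -[X in _ --> X](mulr0 (2 * b)); apply: cvgMr; exact: cvg_harmonic.
apply: (squeeze_cvgr _ (cvg_cst 0) h0); near=> d.
have d2 : (2 <= d)%N by near: d; exact: nbhs_infty_ge.
have [/(_ d d2)[k0 kd dN] _ _] := adm.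
have r0' : 0 < deficit (N d) d (k d) :> R by apply: deficit_gt0 => //; rewrite k0.
rewrite ltW//=; have d0 : 0 < d%:R :> R by rewrite ltr0n (leq_trans _ d2).
have Gd0 : threshold_exponent (d%:R / (N d)%:R) ((k d)%:R / d%:R) <= 0 :> R.
  by apply: ltW; near: d; exact: (cvgr_lt _ Gd).
have rb := hb d d2 Gd0; apply: le_trans (rb) _.
have b0 : 0 < b by have := lt_le_trans r0' rb; rewrite pmulr_lgt0// invr_gt0.
rewrite ler_pdivrMr// [2 * b]mulrC -!mulrA ler_peMr//; first exact: ltW.
by apply: le1_2harmonic; exact: leq_trans d2.
Unshelve. all: by end_near.
Qed.

Lemma cvg_deficit_pinfty (k N : nat -> nat) : admissible delta rho k N -> rho_S delta < rho ->
  forall A : R, \forall d \near \oo, A <= deficit (N d) d (k d).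
Proof.
move=> adm rS A; have [_ ud vd] := adm; have /andP[r0 r1] := rho01.
have G0 := threshold_exponent_gt_rho_S hdelta rho01 rS.
have Gd : (fun d => threshold_exponent (d%:R / (N d)%:R) ((k d)%:R / d%:R)) @ \oo -->
    threshold_exponent delta rho by exact: cvg_threshold_exponent.
have [a a0 ha] := deficit_ge_of_exponent hdelta hrho adm.
set g := threshold_exponent delta rho in G0 Gd.
pose c := a * (g / 2) ^+ 4.
have c0 : 0 < c by rewrite mulr_gt0// exprn_gt0// divr_gt0.
near=> d.
have d2 : (2 <= d)%N by near: d; exact: nbhs_infty_ge.
have [/(_ d d2)[k0 kd dN] _ _] := adm.
apply: (@le_trans _ _ (c * (N d)%:R)).
  have : A / c <= d%:R by near: d; exact: nbhs_infty_ger.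
  rewrite ler_pdivrMr// => h; apply: le_trans h _.
  by rewrite mulrC ler_pM2l// ler_nat ltnW.
apply: le_trans (ha d (g / 2) d2 _ _); last 2 first.
- by rewrite divr_ge0// ltW.
- by apply: ltW; near: d; apply: (cvgr_gt _ Gd); rewrite -/g; lra.
rewrite /c -[leLHS]mulrA -[leRHS]mulrA ler_pM2l// [leLHS]mulrC ler_pM2r;
  last by rewrite exprn_gt0// divr_gt0.
rewrite -natrX ler_nat -[X in (X <= _)%N]expn1 leq_pexp2l//.
exact: leq_ltn_trans dN.
Unshelve. all: by end_near.
Qed.

(** * Oscillation at the critical value *)

Section Critical.
Hypothesis rho_crit : rho = rho_S delta.

Let N (d : nat) : nat := (Num.truncn (d%:R / delta)).+1.
Let u (d : nat) : R := d%:R / (N d)%:R.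
(** The harmonic term keeps [s] positive and [s ^+ 2] at least [1 / (d + 1)], which drives the
    divergence along even [d]. *)
Let s (d : nat) : R := Num.sqrt (`|threshold_exponent (u d) rho| + harmonic d).
(** Rounding goes away from [rho], so [k0 / d] deviates from it by at least [s]. *)
Let k0 (d : nat) : nat :=
  if odd d then Num.truncn ((rho - s d) * d%:R) else (Num.truncn ((rho + s d) * d%:R)).+1.
(** Clamping to [[1, d - 1]] gives admissible values for all [d >= 2]; it has no effect for large
    [d]. *)
Let k (d : nat) : nat := maxn 1 (minn d.-1 (k0 d)).
Let v (d : nat) : R := (k d)%:R / d%:R.

Let ltdN d : (d < N d)%N.
Proof.
have /andP[d0 d1] := delta01.
rewrite ltnS truncn_ge_nat ?divr_ge0 ?(ltW d0)//.
by rewrite ler_pdivlMr// ler_piMr// ltW.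
Qed.

Let cvg_u : u @ \oo --> delta.
Proof.
have /andP[d0 d1] := delta01.
have h0 : (fun n => delta - harmonic n) @ \oo --> delta.
  rewrite -[X in _ --> X]subr0; apply: cvgB; [exact: cvg_cst|exact: cvg_harmonic].
apply: (squeeze_cvgr _ h0 (cvg_cst delta)); near=> d.
have Nd0 : 0 < (N d)%:R :> R by rewrite ltr0n.
have x0 : 0 <= d%:R / delta by rewrite divr_ge0// ltW.
have t1 : (Num.truncn (d%:R / delta))%:R <= d%:R / delta by rewrite -truncn_ge_nat.
have t2 : d%:R / delta < (N d)%:R by exact: truncnS_gt.
apply/andP; split.
  rewrite lerBlDr -lerBlDl.
  have -> : delta - u d = ((N d)%:R * delta - d%:R) / (N d)%:R.
    by rewrite /u; field; rewrite gt_eqF.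
  apply: (@le_trans _ _ (1 / (N d)%:R)).
    rewrite ler_pM2r ?invr_gt0//.
    move: t1; rewrite ler_pdivlMr// /N -natr1 mulrDl; lra.
  by rewrite mul1r lef_pV2 ?posrE// ler_nat.
by rewrite /u ler_pdivrMr// mulrC -ler_pdivrMr// ltW.
Unshelve. all: by end_near.
Qed.

Let threshold_rho : threshold_exponent delta rho = 0.
Proof.
have /andP[r0 r1] := rho01.
have [h|/forallNP h] := pselect (exists z, 0 <= z <= 1 /\ threshold_exponent delta z = 0).
  by have [_] := xgetPex 0 h; rewrite rho_crit.
(* Without a zero, [rho_S delta] would be the default 0, but [rho] is positive. *)
by move: r0; rewrite rho_crit /rho_S xgetPN// ltxx.
Qed.

Let cvg_s : s @ \oo --> (0 : R).
Proof.
have h : (fun d => `|threshold_exponent (u d) rho| + harmonic d) @ \oo --> (0 : R).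
  rewrite -[X in _ --> X]addr0; apply: cvgD; last exact: cvg_harmonic.
  rewrite -[X in _ --> X](@normr0 R R) -threshold_rho; apply: cvg_norm.
  apply: cvg_threshold_exponent => //; exact: cvg_cst.
rewrite -[X in _ --> X]sqrtr0; apply: (continuous_cvg _ _ h).
exact: sqrt_continuous.
Qed.

Let s_sqr d : s d ^+ 2 = `|threshold_exponent (u d) rho| + harmonic d.
Proof. by rewrite sqr_sqrtr// addr_ge0// invr_ge0. Qed.

Let s_gt0 d : 0 < s d.
Proof. by rewrite sqrtr_gt0 ltr_wpDl// invr_gt0. Qed.

Let k0_bounds d : (1 <= d)%N -> s d <= rho ->
  if odd d then (k0 d)%:R / d%:R <= rho - s d <= (k0 d)%:R / d%:R + d%:R^-1
  else rho + s d <= (k0 d)%:R / d%:R <= rho + s d + d%:R^-1.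
Proof.
move=> d1 sr; have d0 : 0 < d%:R :> R by rewrite ltr0n.
have x1 : 0 <= (rho - s d) * d%:R by rewrite mulr_ge0// subr_ge0.
have x2 : 0 <= (rho + s d) * d%:R.
  by rewrite mulr_ge0// addr_ge0// ltW//; have /andP[] := rho01.
rewrite /k0; case: (odd d).
  rewrite ler_pdivrMr// -truncn_ge_nat// leqnn/=.
  rewrite -[X in _ <= _ + X]mul1r -mulrDl ler_pdivlMr// natr1.
  exact/ltW/truncnS_gt.
rewrite ler_pdivlMr// ltW ?truncnS_gt//= -[X in _ <= _ + X]mul1r -lerBlDr -mulrBl.
by rewrite -natr1 addrK ler_pdivrMr// -truncn_ge_nat.
Qed.

Let cvg_s_harmonic : (fun d => s d + 2 * harmonic d) @ \oo --> (0 : R).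
Proof.
rewrite -[X in _ --> X]addr0; apply: cvgD => //.
by rewrite -[X in _ --> X](mulr0 2); apply: cvgMr; exact: cvg_harmonic.
Qed.

Let k_eq : \forall d \near \oo, k d = k0 d /\ s d <= rho.
Proof.
have /andP[r0 r1] := rho01.
near=> d.
have d2 : (2 <= d)%N by near: d; exact: nbhs_infty_ge.
have d1 : (1 <= d)%N by exact: leq_trans d2.
have d0 : 0 < d%:R :> R by rewrite ltr0n.
have sr : s d < rho by near: d; exact: (cvgr_lt _ cvg_s).
have h1 : s d + 2 * harmonic d < Num.min rho (1 - rho).
  by near: d; apply: (cvgr_lt _ cvg_s_harmonic); rewrite lt_min r0 subr_gt0.
have hd : d%:R^-1 <= 2 * harmonic d :> R.
  by rewrite -[leLHS]mul1r ler_pdivrMr// -mulrA le1_2harmonic.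
split; last exact: ltW.
move: h1; rewrite lt_min => /andP[h1 h2].
have := k0_bounds d1 (ltW sr) => hk.
have /andP[k1 k2] : (0 < k0 d < d)%N.
  have sp := s_gt0 d.
  rewrite -(ltr_nat R) -(ltr_nat R (k0 d)) mulr0n.
  have -> : (k0 d)%:R = (k0 d)%:R / d%:R * d%:R :> R by rewrite divfK// gt_eqF.
  have [hk1 hk2] : (0 : R) < (k0 d)%:R / d%:R /\ (k0 d)%:R / d%:R < (1 : R).
    by move: hk; case: (odd d) => /andP[hk1 hk2]; split; lra.
  apply/andP; split; first by rewrite mulr_gt0.
  by rewrite -ltr_pdivlMr// divff// gt_eqF.
rewrite /k (minn_idPr _); last by rewrite -ltnS prednK.
by rewrite (maxn_idPr _).
Unshelve. all: by end_near.
Qed.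

Let admissible_crit : admissible delta rho k N.
Proof.
split.
- move=> d d2; split; [by rewrite leq_maxl| |exact: ltdN].
  by rewrite gtn_max d2 gtn_min prednK ?leqnn// (leq_trans _ d2).
- exact: cvg_u.
have h1 : (fun d => rho - (s d + 2 * harmonic d)) @ \oo --> rho.
  by rewrite -[X in _ --> X]subr0; apply: cvgB => //; exact: cvg_cst.
have h2 : (fun d => rho + (s d + 2 * harmonic d)) @ \oo --> rho.
  by rewrite -[X in _ --> X]addr0; apply: cvgD => //; exact: cvg_cst.
apply: (squeeze_cvgr _ h1 h2); near=> d.
have d1 : (1 <= d)%N by near: d; exact: nbhs_infty_ge.
have d0 : 0 < d%:R :> R by rewrite ltr0n.
have [-> sr] : k d = k0 d /\ s d <= rho by near: d; exact: k_eq.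
have hd : d%:R^-1 <= 2 * harmonic d :> R.
  by rewrite -[leLHS]mul1r ler_pdivrMr// -mulrA le1_2harmonic.
have sp := s_gt0 d.
have hp : 0 <= d%:R^-1 :> R by rewrite invr_ge0.
by have := k0_bounds d1 sr; case: (odd d) => /andP[hk1 hk2]; apply/andP; split; lra.
Unshelve. all: by end_near.
Qed.

(** Half of the limit of [threshold_exponent (u d) 1], hence eventually strictly below it. *)
Let c : R := threshold_exponent delta 1 / 2.

Let c_gt0 : 0 < c.
Proof. by rewrite divr_gt0// threshold_exponent1_gt0. Qed.

Let threshold1_near : \forall d \near \oo, c < threshold_exponent (u d) 1.
Proof.
have h : (fun d => threshold_exponent (u d) 1) @ \oo --> threshold_exponent delta 1.
  rewrite /threshold_exponent; apply: cvgB.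
    apply: cvgD; first exact: cvg_binary_entropy delta01 cvg_u.
    by apply: cvgM => //; exact: cvg_cst.
  apply: cvgM; last exact: cvg_cst.
  by apply: cvgB; [exact: cvg_cst|apply: cvgM => //; exact: cvg_cst].
by apply: (cvgr_gt _ h); rewrite /c; have := threshold_exponent1_gt0 hdelta; lra.
Qed.

(** For odd [d] the two concavity estimates use [rho] as the right end point of the interval, for
    even [d] as the left one. *)
Let exponent_near : \forall d \near \oo,
  if odd d then threshold_exponent (u d) (v d) <= 0
  else c / 2 * s d <= threshold_exponent (u d) (v d).
Proof.
have /andP[r0 r1] := rho01; have cp := c_gt0.
have [_ _ cvg_v] := admissible_crit.
near=> d.
have d1 : (1 <= d)%N by near: d; exact: nbhs_infty_ge.
have d0 : 0 < d%:R :> R by rewrite ltr0n.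
have [kE sr] : k d = k0 d /\ s d <= rho by near: d; exact: k_eq.
have v0 : 0 < v d by near: d; exact: (cvgr_gt _ cvg_v).
have v1 : v d < 1 by near: d; exact: (cvgr_lt _ cvg_v).
have va : v d < rho + c / 2 by near: d; apply: (cvgr_lt _ cvg_v); lra.
have vb : rho - c / 2 < v d by near: d; apply: (cvgr_gt _ cvg_v); lra.
have hg : c < threshold_exponent (u d) 1 by near: d; exact: threshold1_near.
have u0 : 0 <= u d by rewrite divr_ge0.
have sp := s_gt0 d.
have hG : `|threshold_exponent (u d) rho| <= s d ^+ 2 by rewrite s_sqr lerDl invr_ge0.
have := k0_bounds d1 sr; rewrite -kE -/(v d); case: (odd d) => /andP[hv _].
  apply: (threshold_exponent_le0_below (y := rho) (c := c) (s := s d)) => //; first exact: ltW.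
  - lra.
  - lra.
  - by apply: le_trans hG; exact: ler_norm.
by apply: (threshold_exponent_ge_above (x := rho)) => //; [exact: ltW|lra|lra].
Unshelve. all: by end_near.
Qed.

Lemma critical_oscillation : exists k N : nat -> nat,
  [/\ admissible delta rho k N,
      exists b : R, \forall d \near \oo, odd d -> deficit (N d) d (k d) <= b / d%:R &
      exists2 a : R, 0 < a &
        \forall d \near \oo, ~~ odd d -> a * d%:R <= deficit (N d) d (k d)].
Proof.
exists k, N; split; first exact: admissible_crit.
  have [b hb] := deficit_le_of_exponent_le0 hdelta hrho admissible_crit.
  exists b; near=> d => od; apply: hb; first by near: d; exact: nbhs_infty_ge.
  by have := near exponent_near d; rewrite od; apply.
have [a a0 ha] := deficit_ge_of_exponent hdelta hrho admissible_crit.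
have cp := c_gt0.
exists (a * (c / 2) ^+ 4); first by rewrite mulr_gt0// exprn_gt0// divr_gt0.
near=> d => od.
have d2 : (2 <= d)%N by near: d; exact: nbhs_infty_ge.
have sp := s_gt0 d.
have G0 : c / 2 * s d <= threshold_exponent (u d) (v d).
  by have := near exponent_near d; rewrite (negPf od); apply.
have c2 : 0 < c / 2 by rewrite divr_gt0.
have cs0 : 0 <= c / 2 * s d by apply: ltW; exact: mulr_gt0.
apply: le_trans (ha d _ d2 cs0 G0).
rewrite [leRHS](_ : _ = a * (c / 2) ^+ 4 * ((N d)%:R ^+ 3 * s d ^+ 4)); last by ring.
rewrite ler_pM2l; last by rewrite mulr_gt0// exprn_gt0.
have Nd : d.+1%:R <= (N d)%:R :> R by rewrite ler_nat.
have dS : 0 < d.+1%:R :> R by [].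
have s4 : d.+1%:R^-1 ^+ 2 <= s d ^+ 4.
  have -> : s d ^+ 4 = (s d ^+ 2) ^+ 2 by rewrite -exprM.
  by rewrite ler_sqr ?nnegrE ?invr_ge0 ?sqr_ge0// s_sqr lerDr.
apply: (@le_trans _ _ (d.+1%:R ^+ 3 * d.+1%:R^-1 ^+ 2)).
  rewrite (_ : _ ^+ 3 * _ = d.+1%:R) ?ler_nat//; field.
  by rewrite gt_eqF.
apply: ler_pM; [by rewrite exprn_ge0| by rewrite exprn_ge0 ?invr_ge0| |exact: s4].
by rewrite lerXn2r ?nnegrE.
Unshelve. all: by end_near.
Qed.

End Critical.
End Limits.

Section LimInfSup.
Context {R : realType}.
Local Open Scope ereal_scope.

Lemma limn_einf_eq0 (f : nat -> \bar R) : (\forall n \near \oo, 0 <= f n) ->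
  (forall (e : R) n, (0 < e)%R -> exists2 m, (n <= m)%N & f m <= e%:E) -> limn_einf f = 0.
Proof.
move=> [m0 _ f0] fe; rewrite limn_einf_lim; apply: cvg_lim => //.
apply: cvg_near_cst; near=> n.
have nm : (m0 <= n)%N by near: n; exact: nbhs_infty_ge.
apply/eqP; rewrite eq_le; apply/andP; split.
  apply/lee_addgt0Pr => e e0; rewrite add0e; have [m nm' fm] := fe e n e0.
  by apply: le_trans fm; apply: ereal_inf_lbound; exists m.
by apply: le_ereal_inf_tmp => _ [m /= nm' <-]; apply: f0; exact: leq_trans nm'.
Unshelve. all: by end_near.
Qed.

Lemma limn_esup_eqy (f : nat -> \bar R) :
  (forall (A : R) n, exists2 m, (n <= m)%N & A%:E <= f m) -> limn_esup f = +oo.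
Proof.
move=> fA; rewrite limn_esup_lim; apply: cvg_lim => //.
apply: cvg_near_cst; apply: nearW => n; apply/eqyP => A _; have [m nm Am] := fA A n.
by apply: le_trans Am _; apply: ereal_sup_ubound; exists m.
Qed.

End LimInfSup.

Unset Implicit Arguments.

Theorem theorem4 (R : realType)
  (phi : forall d : nat, probability (borel_rV R d) R)
  (phi_even : forall (d : nat) (A : set (borel_rV R d)), measurable A ->
    phi d [set - x | x in (A : set 'rV[R]_d)] = phi d A)
  (phi_hyperplane : forall (d : nat) (u : 'cV[R]_d), u != 0 ->
    phi d [set x : 'rV[R]_d | x *m u = 0] = 0%E)
  (disp : nat -> nat -> measure_display)
  (Omega : forall d N : nat, measurableType (disp d N))
  (P : forall d N : nat, probability (Omega d N) R)
  (X : forall d N : nat, 'I_N -> {RV (P d N) >-> borel_rV R d})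
  (X_distribution : forall d N : nat, (d < N)%N ->
    forall (i : 'I_N) (A : set (borel_rV R d)), measurable A ->
      distribution (P d N) (X d N i) A = phi d A)
  (X_independent : forall d N : nat, (d < N)%N ->
    mutually_independent (X d N))
  (delta rho : R) (hdelta : 1 / 2 < delta < 1)
  (hrho : 0 < rho < 2 - 1 / delta) :
  (forall k N : nat -> nat, admissible delta rho k N ->
    (exists (h : nat -> R) (a b : R),
      [/\ 0 < a, a <= b,
          forall d : nat, (2 <= d)%N -> a <= h d <= b &
          forall d : nat, (2 <= d)%N ->
            face_deficit (X d (N d)) (k d) =
            (1 / (N d)%:R *
             expR ((N d)%:R * threshold_exponent (d%:R / (N d)%:R)
                                                 ((k d)%:R / d%:R)) *
             h d)%:E]) /\
    (rho < rho_S delta ->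
      (fun d => face_deficit (X d (N d)) (k d)) @ \oo --> 0%E) /\
    (rho_S delta < rho ->
      (fun d => face_deficit (X d (N d)) (k d)) @ \oo --> +oo%E)) /\
  (rho = rho_S delta ->
    exists k N : nat -> nat,
      [/\ admissible delta rho k N,
          limn_einf (fun d => face_deficit (X d (N d)) (k d)) = 0%E &
          limn_esup (fun d => face_deficit (X d (N d)) (k d)) = +oo%E]).
Proof.
have face_deficitE k N : admissible delta rho k N -> forall d, (2 <= d)%N ->
    face_deficit (X d (N d)) (k d) = (deficit (N d) d (k d))%:E.
  move=> [adm _ _] d d2; have [k0 kd dN] := adm d d2.
  rewrite /face_deficit (expected_face_numberE (phi_even d) (phi_hyperplane d)
    (X_distribution d (N d) dN) (X_independent d (N d) dN) dN) ?k0//.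
split=> [k N adm|rS].
  split; last split.
  - have [a [b [a0 ab hab]]] := normalized_deficit_bounded hdelta hrho adm.
    exists (normalized_deficit k N), a, b; split=> // d d2.
    by rewrite (face_deficitE k N adm d d2) (deficitE_normalized adm d2).
  - move=> rS; have h := cvg_deficit0 hdelta hrho adm rS.
    have h' : (fun d => (deficit (N d) d (k d))%:E) @ \oo --> (0 : R)%:E.
      by apply: cvg_EFin => //; exact: nearW.
    apply: cvg_trans h'; apply: near_eq_cvg; near=> d.
    by rewrite face_deficitE//; near: d; exact: nbhs_infty_ge.
  - move=> rS; apply/cvgeyPge => A; have h := cvg_deficit_pinfty hdelta hrho adm rS A.
    near=> d; rewrite face_deficitE//; last by near: d; exact: nbhs_infty_ge.
    by rewrite lee_fin; near: d.
have [k [N [adm [b hb] [a a0 ha]]]] := critical_oscillation hdelta hrho rS.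
exists k, N; split=> //.
- apply: limn_einf_eq0.
    near=> d; have d2 : (2 <= d)%N by near: d; exact: nbhs_infty_ge.
    have [/(_ d d2)[k0 kd dN] _ _] := adm.
    by rewrite face_deficitE// lee_fin ltW// deficit_gt0 ?k0.
  move=> e n e0.
  (* All conditions but parity hold eventually, and [D.*2.+1] is an odd index beyond the bound
     [D]. *)
  have [m [nm m2 om hm bm]] : exists m, [/\ (n <= m)%N, (2 <= m)%N, odd m,
      odd m -> deficit (N m) m (k m) <= b / m%:R & b / e <= m%:R].
    have [D _ hD] : \forall m \near \oo, [/\ (n <= m)%N, (2 <= m)%N,
        odd m -> deficit (N m) m (k m) <= b / m%:R & b / e <= m%:R].
      near=> m; split.
      - by near: m; exact: nbhs_infty_ge.
      - by near: m; exact: nbhs_infty_ge.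
      - by near: m.
      - by near: m; exact: nbhs_infty_ger.
    have [|h1 h2 h3 h4] := hD D.*2.+1; first by rewrite /= -addnn -addnS leq_addr.
    by exists D.*2.+1; split=> //=; rewrite odd_double.
  exists m => //; rewrite face_deficitE// lee_fin; apply: le_trans (hm om) _.
  by rewrite ler_pdivrMr ?ltr0n ?(leq_trans _ m2)// mulrC -ler_pdivrMr.
- apply: limn_esup_eqy => A n.
  have [m [nm m2 om hm bm]] : exists m, [/\ (n <= m)%N, (2 <= m)%N, ~~ odd m,
      ~~ odd m -> a * m%:R <= deficit (N m) m (k m) & A / a <= m%:R].
    have [D _ hD] : \forall m \near \oo, [/\ (n <= m)%N, (2 <= m)%N,
        ~~ odd m -> a * m%:R <= deficit (N m) m (k m) & A / a <= m%:R].
      near=> m; split.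
      - by near: m; exact: nbhs_infty_ge.
      - by near: m; exact: nbhs_infty_ge.
      - by near: m.
      - by near: m; exact: nbhs_infty_ger.
    have [|h1 h2 h3 h4] := hD D.*2; first by rewrite /= -addnn leq_addr.
    by exists D.*2; split=> //=; rewrite odd_double.
  exists m => //; rewrite face_deficitE// lee_fin; apply: le_trans (hm om).
  by rewrite mulrC -ler_pdivrMr.
Unshelve. all: by end_near.
Qed.
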